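(* Let $n\ge2$, let $[n]=D\sqcup U$ be a partition as in the context, and let $y_I$ be the Minkowski coefficients of the associahedron $\mathsf{As}_{n-1}^{D,U}$. Let $I\subseteq[n]$ be non-empty with $v$ nested components and, if $v=1$, let $K_\gamma,K_\Gamma$ be the signed lengths of $I$ and $(a,b)_D=\{d\in D:a<d<b\}$. Then $$y_I=\begin{cases}(-1)^{|I\setminus(a,b)_D|}K_\gamma K_\Gamma & \text{if } v=1 \text{ and } I \text{ is not of the form } \{u_s\} \text{ with } u_s\in U,\\ (n+1)-K_\gamma K_\Gamma & \text{if } I=\{u_s\} \text{ with } u_s\in U,\\ 0&\text{if } v\ge2.\end{cases}$$
   Context: Partition and polygon. $[n]=\{1,\dots,n\}=D\sqcup U$ with $D=\{d_1=1<d_2<\dots<d_\ell=n\}$ ($\ell\ge2$) and $U=\{u_1<\dots<u_m\}$ ($m\ge0$). Put $\overline D=D\cup\{0,n+1\}$. $Q$ is a convex $(n+2)$-gon whose vertices are labelled, in counter-clockwise cyclic order, $0,d_1,\dots,d_\ell,n+1,u_m,\dots,u_1$. A proper diagonal is a pair $\{x,y\}$ of distinct labels not adjacent on the boundary of $Q$. Sets $R_\delta$. For a proper diagonal $\delta=\{x,y\}$, $x<y$: $R_\delta=\{d\in D: x<d<y\}$ if $x,y\in\overline D$; $R_\delta=\{d\in D:d>x\}\cup\{u\in U:u\ge y\}$ if $x\in\overline D,\ y\in U$; $R_\delta=\{d\in D:d<y\}\cup\{u\in U:u\le x\}$ if $x\in U,\ y\in\overline D$; $R_\delta=D\cup\{u\in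 U:u\le x\}\cup\{u\in U:u\ge y\}$ if $x,y\in U$. Nested components. For non-empty $I\subseteq[n]$ write $\overline D\setminus I=\{e_0=0<e_1<\dots<e_k=n+1\}$. The nested components of $I$ are the non-empty sets among $I\cap(e_{i-1},e_i)$, $1\le i\le k$; $v$ is their number. If $v=1$, let $a<b$ be the consecutive elements of $\overline D\setminus I$ with $I\subseteq(a,b)$, and let $\gamma=\min I$, $\Gamma=\max I$. Signed lengths (for $v=1$). $|K_\Gamma|$ is the number of edges of the path in the boundary of $Q$ connecting the vertices $b$ and $\Gamma$ that does not use the vertex $a$, and the integer $K_\Gamma$ is negative if and only if $\Gamma\in D$. $|K_\gamma|$ is the number of edges of the path in the boundary of $Q$ connecting $a$ and $\gamma$ that does not use the vertex $b$, and the integer $K_\gamma$ is negative if and only if $\gamma\in D$. Polytope. $\mathsf{As}_{n-1}^{D,U}=\{x\in\mathbb R^n:\sum_{i\in[n]}x_i=\tfrac{n(n+1)}2,\ \sum_{i\in R_\delta}x_i\ge\tfrac{|R_\delta|(|R_\delta|+1)}2\text{ for all proper diagonals }\delta\}$. Its tight right-hand sides are $z_J=\min_{x\in \mathsf{As}_{n-1}^{D,U}}\sum_{i\in J}x_i$ for $\varnothing\ne J\subseteq[n]$ and $z_\varnothing=0$; its Minkowski coefficients are $y_I=\sum_{J\subseteq I}(-1)^{|I\setminus J|}z_J$ (equivalently, the unique coefficients of its decomposition as Minkowski sum and difference $\sum_I y_I\Delta_I$ of the simplices $\Delta_I=\operatorname{conv}\{e_i:i\in I\}$, $\varnothing\neq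 I\subseteq[n]$). *)

(* Defs.v *)
(* In this order, [set0], [setT], ... denote the finite sets. *)
From mathcomp Require Import boolp classical_sets reals.
From mathcomp Require Import all_boot all_order all_algebra.

Set Implicit Arguments.
Unset Strict Implicit.
Unset Printing Implicit Defensive.

Import Order.TTheory GRing.Theory Num.Theory.

(* The element k of [n] = {1, ..., n} is the (i : 'I_n) with i = k - 1, so that
   a point of R^n is a row vector ; the polygon labels 0, 1, ..., n + 1 are the
   elements of 'I_n.+2, and [lab] is the inclusion of [n] into the labels. *)
Definition lab n (i : 'I_n) : 'I_n.+2 := lift ord0 (lift ord_max i).

Lemma lab_val n (i : 'I_n) : lab i = i.+1 :> nat.
Proof. by rewrite /= /bump (leqNgt n) ltn_ord. Qed.

Definition DU_partition n (D U : {set 'I_n}) : Prop :=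
  [/\ D :|: U = [set: 'I_n], [disjoint D & U],
      (forall i : 'I_n, lab i = 1 :> nat -> i \in D) &
      (forall i : 'I_n, lab i = n :> nat -> i \in D)].

Definition labD n (D : {set 'I_n}) : {set 'I_n.+2} := [set lab i | i in D].

Definition Dbar n (D : {set 'I_n}) : {set 'I_n.+2} :=
  ord0 |: (ord_max |: labD D).

Section Polygon.

Variables (n : nat) (D U : {set 'I_n}).

(* [enum] lists a set of ordinals in increasing order, so this is
   0, d_1, ..., d_l, n+1, u_m, ..., u_1. *)
Definition polygon : seq 'I_n.+2 :=
  ord0 :: [seq lab d | d <- enum D]
    ++ ord_max :: rev [seq lab u | u <- enum U].

Definition boundary_adjacent (x y : 'I_n.+2) : bool :=
  (next polygon x == y) || (next polygon y == x).

Definition proper_diagonal (x y : 'I_n.+2) : bool :=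
  (x != y) && ~~ boundary_adjacent x y.

(* [arc polygon p q] lists the vertices met when going counter-clockwise from
   p (included) to q (excluded), hence its size is a number of edges. For
   p, q, r pairwise distinct, exactly one of the two boundary paths between
   p and q avoids r. *)
Definition boundary_length_avoiding (r p q : 'I_n.+2) : nat :=
  if r \in arc polygon p q then size (arc polygon q p)
  else size (arc polygon p q).

(* Meant for x < y. Every label outside [Dbar D] is the label of some u in U. *)
Definition Rdiag (x y : 'I_n.+2) : {set 'I_n} :=
  match x \in Dbar D, y \in Dbar D with
  | true, true => [set d in D | x < lab d < y]
  | true, false => [set d in D | x < lab d] :|: [set u in U | y <= lab u]
  | false, true => [set d in D | lab d < y] :|: [set u in U | lab u <= x]
  | false, false =>
      D :|: [set u in U | lab u <= x] :|: [set u in U | y <= lab u]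
  end.

End Polygon.

Section NestedComponents.

Variables (n : nat) (D U I : {set 'I_n}).

Definition open_interval (A : {set 'I_n}) (a b : 'I_n.+2) : {set 'I_n} :=
  [set i in A | a < lab i < b].

(* a = e_(i-1) and b = e_i for some i, where Dbar \ I = {e_0 < ... < e_k} *)
Definition consecutive (a b : 'I_n.+2) : bool :=
  let E := Dbar D :\: [set lab i | i in I] in
  [&& a \in E, b \in E, a < b & [forall c in E, ~~ (a < c < b)]].

Definition nested_components : {set {set 'I_n}} :=
  [set open_interval I p.1 p.2 |
     p : 'I_n.+2 * 'I_n.+2 & consecutive p.1 p.2] :\ set0.

Definition nested_number : nat := #|nested_components|.

(* The pair (a, b); the default value is irrelevant, since the pair exists and
   is unique when there is exactly one nested component. *)
Definition nested_ends : 'I_n.+2 * 'I_n.+2 :=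
  odflt (ord0, ord_max)
    [pick p : 'I_n.+2 * 'I_n.+2 |
       consecutive p.1 p.2 & I \subset open_interval [set: 'I_n] p.1 p.2].

(* The labels of min I and max I; the default values only matter for I empty. *)
Definition gamma_min : 'I_n.+2 :=
  odflt ord0 (omap (@lab n) [pick i in I | [forall j in I, i <= j]]).

Definition Gamma_max : 'I_n.+2 :=
  odflt ord0 (omap (@lab n) [pick i in I | [forall j in I, j <= i]]).

Definition signed_length (p q r : 'I_n.+2) : int :=
  let len := Posz (boundary_length_avoiding D U r p q) in
  if q \in labD D then (- len)%R else len.

Definition K_Gamma : int :=
  signed_length nested_ends.2 Gamma_max nested_ends.1.

Definition K_gamma : int :=
  signed_length nested_ends.1 gamma_min nested_ends.2.

End NestedComponents.

Local Open Scope ring_scope.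

Section Associahedron.

Variables (R : realType) (n : nat) (D U : {set 'I_n}).

Definition associahedron : set 'rV[R]_n :=
  [set x : 'rV[R]_n |
     \sum_i x 0 i = (n * n.+1)%:R / 2 /\
     forall a b : 'I_n.+2, (a < b)%N -> proper_diagonal D U a b ->
       (#|Rdiag D U a b| * #|Rdiag D U a b|.+1)%:R / 2
         <= \sum_(i in Rdiag D U a b) x 0 i]%classic.

Definition is_minimum (A : set R) (m : R) : Prop := A m /\ lbound A m.

(* [xget 0 P] is some m satisfying P, if there is one. *)
Definition tight_rhs (J : {set 'I_n}) : R :=
  if J == set0 then 0
  else xget 0 (is_minimum
         [set \sum_(i in J) (x : 'rV[R]_n) 0 i | x in associahedron]%classic).

Definition minkowski_coeff (I : {set 'I_n}) : R :=
  \sum_(J : {set 'I_n} | J \subset I) (-1) ^+ #|I :\: J| * tight_rhs J.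

End Associahedron.

Arguments associahedron R {n} D U.
Arguments tight_rhs R {n} D U J.
Arguments minkowski_coeff R {n} D U I.

(* Main.v *)
Require Import Defs.
From mathcomp Require Import classical_sets reals.
From mathcomp Require Import all_boot all_order all_algebra.
From mathcomp Require Import zify ring lra.

(* A subset J of [n] corresponds to the x-monotone path from 0 to n + 1 through
   the labels of D \ J and of U & J, and the indicator of J is the sum of the
   indicators of R_e over the edges e of that path, minus |U & J| times the
   indicator of [n].  Hence every x in the associahedron satisfies
     x(J) >= path_value J := sum_e T(|R_e|) - |U & J| T(n),  T(t) = t (t+1) / 2.
   Adding i to J inserts or removes one vertex of the path; as |R_vw| is a
   function of w minus a function of v and T is quadratic, the increment of
   path_value is the product of two differences (Loday's formula) for i in D,
   and n + 1 minus such a product for i in U.  These increments grow with J, so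
   path_value is supermodular, the greedy algorithm yields a point attaining any
   given bound, and z_J = path_value J.  In the alternating sum defining y_I,
   take differences first in min I, then in max I: only the subset of the
   elements of D strictly between them survives, and it contributes the product
   K_gamma K_Gamma up to sign. *)

Set Implicit Arguments.
Unset Strict Implicit.
Unset Printing Implicit Defensive.

Import Order.TTheory GRing.Theory Num.Theory.
Local Open Scope ring_scope.

(** * Strict neighbours of a point in a finite subset of a chain *)

Section Neighbours.

Variables (k : nat) (P : {set 'I_k.+1}).
Implicit Types v w : 'I_k.+1.

Definition succ_in v : 'I_k.+1 :=
  [arg min_(w < ord_max | (w \in P) && (v < w)%N) (w : nat)].

Definition pred_in v : 'I_k.+1 :=
  [arg max_(w > ord0 | (w \in P) && (w < v)%N) (w : nat)].

Lemma succ_inP v : ord_max \in P -> (v < k)%N ->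
  [/\ succ_in v \in P, (v < succ_in v)%N &
      forall w, w \in P -> (v < w)%N -> (succ_in v <= w)%N].
Proof.
move=> Pmax v_lt; rewrite /succ_in; case: arg_minnP => [|w /andP[wP vw] w_min].
  by rewrite Pmax.
by split=> // w' w'P vw'; apply: w_min; rewrite w'P.
Qed.

Lemma pred_inP v : ord0 \in P -> (0 < v)%N ->
  [/\ pred_in v \in P, (pred_in v < v)%N &
      forall w, w \in P -> (w < v)%N -> (w <= pred_in v)%N].
Proof.
move=> P0 v_gt; rewrite /pred_in; case: arg_maxnP => [|w /andP[wP wv] w_max].
  by rewrite P0.
by split=> // w' w'P vw'; apply: w_max; rewrite w'P.
Qed.

Lemma succ_in_eq v w : ord_max \in P -> w \in P -> (v < w)%N ->
  (forall w', w' \in P -> (v < w' < w)%N -> False) -> succ_in v = w.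
Proof.
move=> Pmax wP vw no; have vk : (v < k)%N by have := ltn_ord w; lia.
have [sP vs s_min] := succ_inP Pmax vk; apply: val_inj => /=.
have := s_min w wP vw; have := no _ sP; lia.
Qed.

Lemma pred_in_eq v w : ord0 \in P -> w \in P -> (w < v)%N ->
  (forall w', w' \in P -> (w < w' < v)%N -> False) -> pred_in v = w.
Proof.
move=> P0 wP vw no; have vk : (0 < v)%N by lia.
have [sP vs s_max] := pred_inP P0 vk; apply: val_inj => /=.
have := s_max w wP vw; have := no _ sP; lia.
Qed.

End Neighbours.

(** * Sums over the edges of a monotone path *)

Section PathSums.

Variables (R : comNzRingType) (k : nat) (g : 'I_k.+1 -> 'I_k.+1 -> R).
Implicit Types (P : {set 'I_k.+1}) (v w : 'I_k.+1).

Definition path_sum P : R := \sum_(v in P :\ ord_max) g v (succ_in P v).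

Lemma succ_in_setU1 P v : ord_max \in P -> (v < k)%N ->
  succ_in (v |: P) v = succ_in P v.
Proof.
move=> Pmax vk; have [sP vs s_min] := succ_inP Pmax vk.
apply: succ_in_eq; rewrite ?inE ?sP ?Pmax ?orbT //.
move=> w; rewrite !inE => /orP[/eqP-> | wP] vws; first lia.
by have := s_min w wP; lia.
Qed.

Lemma pred_in_setU1 P v : ord0 \in P -> (0 < v)%N ->
  pred_in (v |: P) v = pred_in P v.
Proof.
move=> P0 vk; have [sP vs s_min] := pred_inP P0 vk.
apply: pred_in_eq; rewrite ?inE ?sP ?P0 ?orbT //.
move=> w; rewrite !inE => /orP[/eqP-> | wP] vws; first lia.
by have := s_min w wP; lia.
Qed.

(** The new vertex splits one edge, from its predecessor to its successor, into two; every other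
    edge keeps both its ends. *)
Lemma path_sum_setU1 P v : ord0 \in P -> ord_max \in P -> v \notin P ->
  path_sum (v |: P) =
  path_sum P - g (pred_in P v) (succ_in P v)
    + (g (pred_in P v) v + g v (succ_in P v)).
Proof.
move=> P0 Pmax vP.
have v_gt0 : (0 < v)%N.
  by rewrite lt0n; apply: contraNneq vP => v0; rewrite (_ : v = ord0) //; apply: val_inj.
have v_ltk : (v < k)%N.
  rewrite ltn_neqAle -ltnS ltn_ord andbT.
  by apply: contraNneq vP => v0; rewrite (_ : v = ord_max) //; apply: val_inj.
have [pP pv p_max] := pred_inP P0 v_gt0.
have [sP vs s_min] := succ_inP Pmax v_ltk.
set p := pred_in P v in pP pv p_max *; set q := succ_in P v in sP vs s_min *.
have vE : v != ord_max by apply: contraNneq vP => ->.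
have pE : p != ord_max by rewrite -val_eqE /=; lia.
rewrite /path_sum (_ : (v |: P) :\ ord_max = v |: (P :\ ord_max)); last first.
  by apply/setP => w; rewrite !inE; case: eqVneq => //= ->; rewrite eq_sym (negPf vE).
rewrite big_setU1 ?inE ?(negPf vP) ?andbF //= succ_in_setU1 // -/q.
have pPk : p \in P :\ ord_max by rewrite !inE pE.
rewrite (big_setD1 p pPk) [in RHS](big_setD1 p pPk) /=.
have -> : succ_in P p = q.
  apply: succ_in_eq => //; first exact: ltn_trans pv vs.
  move=> w wP pwq; case: (ltngtP w v) => wv.
  - by move: pwq (p_max w wP wv); clear; lia.
  - by move: pwq (s_min w wP wv); clear; lia.
  - by rewrite (val_inj wv) (negPf vP) in wP.
have -> : succ_in (v |: P) p = v.
  apply: succ_in_eq; rewrite ?inE ?eqxx ?Pmax ?orbT //.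
  move=> w; rewrite !inE => /orP[/eqP-> | wP] pwq; first by move: pwq; clear; lia.
  by move: pwq (p_max w wP); clear; lia.
have -> : \sum_(i in (P :\ ord_max) :\ p) g i (succ_in (v |: P) i) =
          \sum_(i in (P :\ ord_max) :\ p) g i (succ_in P i).
  apply: eq_bigr => w; rewrite !inE => /and3P[wp wk wP]; congr g.
  have wk' : (w < k)%N.
    by move: (ltn_ord w) wk; rewrite -val_eqE /=; clear; lia.
  have [tP wt t_min] := succ_inP Pmax wk'.
  apply: succ_in_eq; rewrite ?inE ?tP ?Pmax ?orbT //.
  move=> w'; rewrite !inE => /orP[/eqP-> | w'P] wwt; last first.
    by move: wwt (t_min w' w'P); clear; lia.
  have := p_max w wP; rewrite -val_eqE /= in wp.
  by move: pv wp wwt (p_max w wP) (t_min p pP); clear; lia.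
by ring.
Qed.

Lemma path_sum_ends : (0 < k)%N -> path_sum [set ord0; ord_max] = g ord0 ord_max.
Proof.
move=> k_gt0.
rewrite /path_sum (_ : _ :\ _ = [set ord0]); last first.
  apply/setP => w; rewrite !inE -!val_eqE /=; lia.
rewrite big_set1; congr g.
apply: succ_in_eq; rewrite ?inE ?eqxx ?orbT // => w; rewrite !inE -!val_eqE /=; lia.
Qed.

End PathSums.

(** Summation by parts: an inner vertex is the right end of one edge and the left end of the next,
    so it collects [f v - h v]. The induction removes one inner vertex at a time. *)
Lemma path_sum_additive (R : comNzRingType) (k : nat) (f h : 'I_k.+1 -> R)
    (P : {set 'I_k.+1}) : (0 < k)%N -> ord0 \in P -> ord_max \in P ->
  path_sum (fun v w => f w - h v) P =
  f ord_max - h ord0 + \sum_(v in P :\ ord0 :\ ord_max) (f v - h v).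
Proof.
move=> k_gt0 P0 Pmax.
pose ends : {set 'I_k.+1} := [set ord0; ord_max].
have [m] := ubnP #|P :\ ord0 :\ ord_max|; elim: m P P0 Pmax => // m IH P P0 Pmax.
have [inner0 _ | [v]] := set_0Vmem (P :\ ord0 :\ ord_max).
  rewrite inner0 big_set0 addr0 (_ : P = ends) ?path_sum_ends //.
  apply/setP => w; move/setP/(_ w): inner0; rewrite !inE.
  by do 2![case: eqVneq => [->|_] //=] => ->.
rewrite !inE => /and3P[vmax v0 vP]; rewrite (cardsD1 v) !inE vmax v0 vP => lt_m.
have Qm : ((P :\ v) :\ ord0) :\ ord_max = ((P :\ ord0) :\ ord_max) :\ v.
  by apply/setP => w; rewrite !inE; do ?case: eqP.
have Q0 : ord0 \in P :\ v by rewrite !inE eq_sym v0.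
have Qmax : ord_max \in P :\ v by rewrite !inE eq_sym vmax.
rewrite -{1}(setD1K vP) path_sum_setU1 ?setD11 //.
rewrite IH // ?Qm; last by rewrite -ltnS.
rewrite [in RHS](big_setD1 v) /= ?inE ?vmax ?v0 //.
by ring.
Qed.

Definition step (k : nat) (P : {set 'I_k.+1}) (v w : 'I_k.+1) : Prop :=
  [/\ v \in P, w \in P, (v < w)%N &
      forall u : 'I_k.+1, u \in P -> (v < u < w)%N -> False].

Lemma step_succ_in (k : nat) (P : {set 'I_k.+1}) (v : 'I_k.+1) :
  ord_max \in P -> v \in P :\ ord_max -> step P v (succ_in P v).
Proof.
rewrite !inE => Pmax /andP[vmax vP].
have vk : (v < k)%N by move: (ltn_ord v) vmax; rewrite -val_eqE /=; clear; lia.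
have [sP vs s_min] := succ_inP Pmax vk; split=> // u uP vus.
by move: vus (s_min u uP); clear; lia.
Qed.

Lemma eq_path_sum (R : comNzRingType) (k : nat) (g h : 'I_k.+1 -> 'I_k.+1 -> R)
    (P : {set 'I_k.+1}) : ord_max \in P ->
  (forall v w, step P v w -> g v w = h v w) -> path_sum g P = path_sum h P.
Proof. by move=> Pmax gh; apply: eq_bigr => v /(step_succ_in Pmax)/gh. Qed.

Lemma ler_path_sum (R : numDomainType) (k : nat) (g h : 'I_k.+1 -> 'I_k.+1 -> R)
    (P : {set 'I_k.+1}) : ord_max \in P ->
  (forall v w, step P v w -> g v w <= h v w) -> path_sum g P <= path_sum h P.
Proof. by move=> Pmax gh; apply: ler_sum => v /(step_succ_in Pmax)/gh. Qed.

(** * Labels: 0, n + 1 and the images of [n] *)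

Local Arguments lab {n} i : simpl never.

Lemma lab_inj n : injective (@lab n).
Proof. by move=> i j /(congr1 (@nat_of_ord _)); rewrite !lab_val => -[/val_inj]. Qed.

Variant label_spec n (v : 'I_n.+2) : Prop :=
  | LabelZero of v = ord0
  | LabelMax of v = ord_max
  | LabelLab i of v = lab i.

Lemma labelP n (v : 'I_n.+2) : label_spec v.
Proof.
case: (posnP v) => [v0|v_gt0]; first by apply: LabelZero; apply: val_inj.
case: (ltngtP v n.+1) => [v_lt|v_gt|vmax]; last first.
- by apply: LabelMax; apply: val_inj.
- by have := ltn_ord v; lia.
have lt_n : (v.-1 < n)%N by lia.
apply: (@LabelLab _ _ (Ordinal lt_n)); apply: val_inj.
by rewrite [RHS]lab_val /= prednK.
Qed.

Lemma lab_neq0 n (i : 'I_n) : lab i != ord0.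
Proof. by apply/eqP => /(congr1 (@nat_of_ord _)); rewrite lab_val. Qed.

Lemma lab_neq_max n (i : 'I_n) : lab i != ord_max.
Proof.
apply/eqP => /(congr1 (@nat_of_ord _)); rewrite lab_val => -[i_n].
by have := ltn_ord i; rewrite i_n ltnn.
Qed.

Lemma sum_mem (V : nmodType) (T : finType) (A : {set T}) (F : T -> V) :
  \sum_(i in A) F i = \sum_i (if i \in A then F i else 0).
Proof. exact: big_mkcond. Qed.

Lemma sum_mem_cond (V : nmodType) (T : finType) (A : {set T}) (Q : pred T)
    (F : T -> V) :
  \sum_(i in A | Q i) F i = \sum_i (if (i \in A) && Q i then F i else 0).
Proof. exact: big_mkcond. Qed.

(** * The weight of R_vw as a difference of a head and a tail weight *)

Section Weights.

Variables (R : comNzRingType) (n : nat) (D : {set 'I_n}) (x : 'I_n -> R).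

Lemma lab_Dbar i : (lab i \in Dbar D) = (i \in D).
Proof.
rewrite /Dbar !in_setU1 (negPf (lab_neq0 i)) (negPf (lab_neq_max i)) /=.
exact: mem_imset (@lab_inj n).
Qed.

Lemma ord0_Dbar : ord0 \in Dbar D.
Proof. by rewrite !inE eqxx. Qed.

Lemma ord_max_Dbar : ord_max \in Dbar D.
Proof. by rewrite !inE eqxx orbT. Qed.

(* head_weight and tail_weight split the weight of R_vw as a function of w minus
   a function of v, see sum_Rdiag. *)
Definition tail_weight (v : 'I_n.+2) : R :=
  if v \in Dbar D then \sum_(i in D | (lab i <= v)%N) x i
  else - \sum_(i in ~: D | (lab i <= v)%N) x i.

Definition head_weight (w : 'I_n.+2) : R :=
  if w \in Dbar D then \sum_(i in D | (lab i < w)%N) x i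
  else \sum_(i in D) x i + \sum_(i in ~: D | (w <= lab i)%N) x i.

(** Both sides are rewritten as sums over all of [n]; the coefficients of [x i] then agree for each
    position of [lab i] relative to [v] and [w]. *)
Lemma sum_Rdiag (v w : 'I_n.+2) : (v < w)%N ->
  \sum_(i in Rdiag D (~: D) v w) x i = head_weight w - tail_weight v.
Proof.
move=> vw; rewrite /Rdiag /head_weight /tail_weight.
case: (v \in Dbar D); case: (w \in Dbar D);
  rewrite ?sum_mem_cond ?sum_mem /=
    -?sumrN -?big_split /=;
  apply: eq_bigr => i _; rewrite !inE; case: (i \in D) => /=;
  case: (ltngtP (lab i) v) => iv /=; case: (ltngtP (lab i) w) => iw /=;
  first [ring | by move: vw iv iw; clear; lia].
Qed.

(** For i in D the two sums over D differ only by the strictness of the bound at i. For i in U the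
    sums over D, over the upper labels up to i and over those from i on add up, so that i is counted
    twice. *)
Lemma head_sub_tail_weight i : head_weight (lab i) - tail_weight (lab i) =
  if i \in D then - x i else \sum_j x j + x i.
Proof.
have xiE : x i = \sum_j (if j == i then x j else 0) by rewrite -big_mkcond big_pred1_eq.
rewrite /head_weight /tail_weight lab_Dbar xiE; case: ifP => iD;
  rewrite ?sum_mem_cond ?sum_mem
    -?sumrN -?big_split -?sumrN -?big_split;
  apply: eq_bigr => j _; rewrite ?inE !lab_val !ltnS -val_eqE /=;
  case: (ltngtP j i) => [_|_|/val_inj ->]; rewrite ?iD /=; try ring;
  by case: (j \in D) => /=; ring.
Qed.

End Weights.

(** * The path attached to a subset of [n] *)

Section Paths.

Variables (n : nat) (D : {set 'I_n}).
Implicit Types (J : {set 'I_n}) (i : 'I_n).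

(* In the polygon, the elements of D in J lie below this path and the elements
   of U outside J lie above it. *)
Definition path_of J : {set 'I_n.+2} :=
  ord0 |: (ord_max |: [set lab i | i in (D :\: J) :|: (J :\: D)]).

Lemma ord0_path J : ord0 \in path_of J.
Proof. by rewrite !inE eqxx. Qed.

Lemma ord_max_path J : ord_max \in path_of J.
Proof. by rewrite !inE eqxx orbT. Qed.

Lemma lab_path J i : (lab i \in path_of J) = (i \in D) (+) (i \in J).
Proof.
rewrite /path_of !in_setU1 (negPf (lab_neq0 i)) (negPf (lab_neq_max i)) /=.
rewrite (mem_imset _ _ (@lab_inj n)) !inE.
by case: (i \in D); case: (i \in J).
Qed.

Lemma path_ofD i J : i \in D -> i \notin J -> path_of J = lab i |: path_of (i |: J).
Proof.
move=> iD iJ; apply/setP => v; rewrite [in RHS]in_setU1; case: (labelP v) => [->|->|j ->].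
- by rewrite !ord0_path orbT.
- by rewrite !ord_max_path orbT.
rewrite !lab_path (inj_eq (@lab_inj n)) in_setU1.
by case: eqVneq => //= ->; rewrite iD (negPf iJ).
Qed.

Lemma path_ofU i J : i \notin D -> i \notin J -> path_of (i |: J) = lab i |: path_of J.
Proof.
move=> iD iJ; apply/setP => v; rewrite [in RHS]in_setU1; case: (labelP v) => [->|->|j ->].
- by rewrite !ord0_path orbT.
- by rewrite !ord_max_path orbT.
rewrite !lab_path (inj_eq (@lab_inj n)) in_setU1.
by case: eqVneq => //= ->; rewrite (negPf iD).
Qed.

(** By summation by parts, the ends contribute x(D), each vertex in D \ J takes away its own [x i],
    and each vertex in J \ D adds [x i] and once the total weight. *)
Lemma path_sum_weights (R : comNzRingType) (x : 'I_n -> R) J :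
  path_sum (fun v w => \sum_(i in Rdiag D (~: D) v w) x i) (path_of J) =
  \sum_(i in J) x i + #|J :\: D|%:R * \sum_i x i.
Proof.
rewrite (@eq_path_sum _ _ _ (fun v w => head_weight D x w - tail_weight D x v)); first last.
- by move=> v w [_ _ vw _]; rewrite sum_Rdiag.
- exact: ord_max_path.
rewrite path_sum_additive ?ord0_path ?ord_max_path //.
have -> : head_weight D x ord_max = \sum_(i in D) x i.
  rewrite /head_weight ord_max_Dbar; apply: eq_bigl => i; rewrite lab_val /= ltnS ltn_ord.
  by rewrite andbT.
have -> : tail_weight D x ord0 = 0.
  by rewrite /tail_weight ord0_Dbar big1 // => i /andP[_]; rewrite lab_val.
rewrite (_ : _ :\ _ = [set lab i | i in (D :\: J) :|: (J :\: D)]); last first.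
  apply/setP => v; rewrite !inE; case: (labelP v) => [->|->|i ->].
  - rewrite eqxx /= ?andbF; apply/esym/imsetP => -[i _ /eqP].
    by rewrite eq_sym (negPf (lab_neq0 i)).
  - rewrite eqxx /=; apply/esym/imsetP => -[i _ /eqP].
    by rewrite eq_sym (negPf (lab_neq_max i)).
  - by rewrite (negPf (lab_neq0 i)) (negPf (lab_neq_max i)).
rewrite big_imset /=; last by move=> i j _ _ /(@lab_inj n).
rewrite (eq_bigr _ (fun i _ => head_sub_tail_weight D x i)).
rewrite subr0 big_mkcond /= [in RHS]mulr_natl -sumr_const.
rewrite !sum_mem /= -!big_split /=.
by apply: eq_bigr => i _; rewrite !inE; case: (i \in D); case: (i \in J) => /=; ring.
Qed.

End Paths.

(** * The greedy algorithm for a supermodular function *)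

Section Greedy.

Variables (R : numDomainType) (T : finType) (f : {set T} -> R).
Hypothesis f0 : f set0 = 0.
Hypothesis marginal_incr : forall (A B : {set T}) (i : T),
  A \subset B -> i \notin B -> f (i |: A) - f A <= f (i |: B) - f B.

(** Induction on [B]: remove a well chosen [j], take the point given for [B :\ j], and let
    coordinate [j] be the marginal [f B - f (B :\ j)]. *)
Lemma greedy_tight (B J : {set T}) : J \subset B ->
  exists x : T -> R,
    [/\ forall A : {set T}, A \subset B -> f A <= \sum_(i in A) x i,
        \sum_(i in J) x i = f J & \sum_(i in B) x i = f B].
Proof.
have [m] := ubnP #|B|; elim: m B J => // m IH B J; rewrite ltnS => Bm JB.
have [B0 | [j0 j0B]] := set_0Vmem B.
  exists (fun=> 0); move: JB; rewrite B0 subset0 => /eqP->; rewrite big_set0 f0.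
  by split=> // A; rewrite subset0 => /eqP->; rewrite big_set0 f0.
(* Choosing [j] outside [J] lets tightness at [J] come from the induction; if [J = B] there is no
   such [j], but tightness at [B] suffices. *)
have [j [jB jJ]] : exists j, j \in B /\ (J = B \/ j \notin J).
  case: (eqVneq J B) => [->|JneB]; first by exists j0; split=> //; left.
  have /subsetPn[j jB jJ] : ~~ (B \subset J).
    by apply: contra JneB => BJ; rewrite eqEsubset JB.
  by exists j; split=> //; right.
have J'B : (J :\ j) \subset B :\ j by apply: setSD.
have ltm : (#|B :\ j| < m)%N by move: Bm; rewrite (cardsD1 j B) jB.
have [x [xA xJ xB]] := IH _ _ ltm J'B.
pose y i := if i == j then f B - f (B :\ j) else x i.
have yE (A : {set T}) : j \notin A -> \sum_(i in A) y i = \sum_(i in A) x i.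
  move=> jA; apply: eq_bigr => i iA; rewrite /y; case: eqVneq => // ij.
  by rewrite -ij iA in jA.
have yB : \sum_(i in B) y i = f B.
  by rewrite (big_setD1 j jB) /= yE ?setD11 // xB /y eqxx subrK.
exists y; split=> //; last first.
  case: jJ => [-> //|jJ].
  have JE : J :\ j = J.
    by apply/setP => i; rewrite !inE; case: eqVneq => // ->; rewrite (negPf jJ).
  by rewrite JE in xJ; rewrite yE.
move=> A AB; case: (boolP (j \in A)) => jA; last first.
  by rewrite yE //; apply: xA; rewrite subsetD1 AB.
rewrite (big_setD1 j jA) /= yE ?setD11 // {1}/y eqxx.
have AB' : (A :\ j) \subset B :\ j by apply: setSD.
(* The coordinate at [j] is the marginal of [j] over [B :\ j], hence at least its marginal over the
   smaller set [A :\ j]. *)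
have := marginal_incr AB' (negbT (setD11 j B)); rewrite !setD1K // => incr.
by rewrite -lerBlDr; apply: le_trans incr; rewrite lerD2l lerN2 xA.
Qed.

End Greedy.

(** * Path values, their increments and their supermodularity *)

Section Cells.

Variables (R : realFieldType) (n : nat) (D : {set 'I_n}).
Implicit Types (J K : {set 'I_n}) (i : 'I_n) (v w : 'I_n.+2).

Definition triangular (t : R) : R := t * (t + 1) / 2.

Definition tail_count : 'I_n.+2 -> R := tail_weight D (fun=> 1).
Definition head_count : 'I_n.+2 -> R := head_weight D (fun=> 1).

Lemma card_Rdiag v w : (v < w)%N -> #|Rdiag D (~: D) v w|%:R = head_count w - tail_count v.
Proof. by move=> vw; rewrite -sum_Rdiag // sumr_const. Qed.

Lemma head_count_labD i : i \in D -> head_count (lab i) = tail_count (lab i) - 1.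
Proof.
move=> iD; have := head_sub_tail_weight D (fun=> 1 : R) i; rewrite iD.
by rewrite -/tail_count -/head_count => <-; rewrite addrC subrK.
Qed.

Lemma head_count_labU i : i \notin D -> head_count (lab i) = tail_count (lab i) + n.+1%:R.
Proof.
move=> iD; have := head_sub_tail_weight D (fun=> 1 : R) i; rewrite (negPf iD).
by rewrite sumr_const card_ord -/tail_count -/head_count -natr1 => <-; rewrite addrC subrK.
Qed.

(** Tail counts are non-negative and increasing on [Dbar D], non-positive and decreasing on the
    labels of U. *)
Lemma tail_count_le v w : (w <= v)%N ->
  if v \in Dbar D then tail_count w <= tail_count v else tail_count v <= tail_count w.
Proof.
move=> wv; rewrite /tail_count /tail_weight; case: (v \in Dbar D); case: (w \in Dbar D);
  rewrite !sum_mem_cond -?sumrN; apply: ler_sum => i _; rewrite ?inE;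
  case: (i \in D) => /=; rewrite ?oppr0 //;
  case: (leqP (lab i) v) => iv; case: (leqP (lab i) w) => iw; rewrite ?oppr0 ?oppr_le0 ?ler01 //;
  by move: wv iv iw; clear; lia.
Qed.

(** Head counts increase up to at most |D| on [Dbar D], and decrease while staying above |D| on the
    labels of U. *)
Lemma head_count_le v w : (v <= w)%N ->
  if v \in Dbar D then head_count v <= head_count w else head_count w <= head_count v.
Proof.
move=> wv; rewrite /head_count /head_weight; case: (v \in Dbar D); case: (w \in Dbar D);
  rewrite !sum_mem_cond ?sum_mem -?big_split; apply: ler_sum => i _; rewrite ?inE /=;
  case: (i \in D) => /=; rewrite ?add0r ?addr0 //;
  case: (ltnP (lab i) v) => iv; case: (ltnP (lab i) w) => iw; rewrite ?ler01 //;
  by move: wv iv iw; clear; lia.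
Qed.

(** Enlarging [J] only deletes labels of D from the path and inserts labels of U. If the predecessor
    moves left, the old one was a deleted label of D; if it moves right, the new one is an inserted
    label of U. Either way [tail_count_le] gives the bound. *)
Lemma tail_count_pred_le J K v : J \subset K -> (0 < v)%N ->
  tail_count (pred_in (path_of D K) v) <= tail_count (pred_in (path_of D J) v).
Proof.
move=> JK v_gt.
have [pJ pJv J_max] := pred_inP (ord0_path D J) v_gt.
have [pK pKv K_max] := pred_inP (ord0_path D K) v_gt.
case: (ltngtP (pred_in (path_of D K) v) (pred_in (path_of D J) v)) => [lt|lt|eq].
- have := tail_count_le (ltnW lt); case: ifP => [_|/negP[]]; first exact: id.
  move: pJ lt (K_max _ ^~ pJv); case: (labelP (pred_in (path_of D J) v)) => [->|->|i ->].
  + by rewrite ord0_Dbar.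
  + by rewrite ord_max_Dbar.
  rewrite !lab_path lab_Dbar; case: (i \in D) => //= iJ; rewrite (subsetP JK) //=.
  by move=> lt /(_ isT); rewrite leqNgt lt.
- have := tail_count_le (ltnW lt); case: ifP => [Dp _|_]; last exact: id.
  exfalso; move: Dp.
  move: pK lt (J_max _ ^~ pKv); case: (labelP (pred_in (path_of D K) v)) => [->|->|i ->].
  + by [].
  + by move=> _ lt; rewrite ord_max_path leqNgt lt => /(_ isT).
  rewrite !lab_path lab_Dbar => + + + iD; rewrite iD /= => iK lt.
  by rewrite leqNgt lt (contra (subsetP JK _) iK) => /(_ isT).
- by rewrite (val_inj eq).
Qed.

(** The mirror image of [tail_count_pred_le]. *)
Lemma head_count_succ_le J K v : J \subset K -> (v < n.+1)%N ->
  head_count (succ_in (path_of D J) v) <= head_count (succ_in (path_of D K) v).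
Proof.
move=> JK v_lt.
have [sJ sJv J_min] := succ_inP (ord_max_path D J) v_lt.
have [sK sKv K_min] := succ_inP (ord_max_path D K) v_lt.
case: (ltngtP (succ_in (path_of D J) v) (succ_in (path_of D K) v)) => [lt|lt|eq].
- have := head_count_le (ltnW lt); case: ifP => [_|/negP[]]; first exact: id.
  move: sJ lt (K_min _ ^~ sJv); case: (labelP (succ_in (path_of D J) v)) => [->|->|i ->].
  + by rewrite ord0_Dbar.
  + by rewrite ord_max_Dbar.
  rewrite !lab_path lab_Dbar; case: (i \in D) => //= iJ; rewrite (subsetP JK) //=.
  by move=> lt /(_ isT); rewrite leqNgt lt.
- have := head_count_le (ltnW lt); case: ifP => [Dp _|_]; last exact: id.
  exfalso; move: Dp.
  move: sK lt (J_min _ ^~ sKv); case: (labelP (succ_in (path_of D K) v)) => [->|->|i ->].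
  + by move=> _ lt; rewrite ord0_path leqNgt lt => /(_ isT).
  + by move=> _ lt; rewrite ord_max_path leqNgt lt => /(_ isT).
  rewrite !lab_path lab_Dbar => + + + iD; rewrite iD /= => iK lt.
  by rewrite leqNgt lt (contra (subsetP JK _) iK) => /(_ isT).
- by rewrite (val_inj eq).
Qed.

(** On an edge, [head_count w - tail_count v] is |R_vw|; written as a difference it turns the
    increments into polynomial identities. *)
Definition path_value J : R :=
  path_sum (fun v w => triangular (head_count w - tail_count v)) (path_of D J)
    - #|J :\: D|%:R * triangular n%:R.

(** The neighbours are strict, so they do not depend on whether [lab i] is itself on the path. *)
Definition loday J i : R :=
  (head_count (succ_in (path_of D J) (lab i)) - head_count (lab i))
    * (tail_count (lab i) - tail_count (pred_in (path_of D J) (lab i))).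

Lemma lab_gt0 i : (0 < lab i)%N.
Proof. by rewrite lab_val. Qed.

Lemma lab_lt i : (lab i < n.+1)%N.
Proof. by rewrite lab_val ltnS. Qed.

(** Two edges of sizes a - 1 and b merge into one of size a + b, and T(a + b) - T(a - 1) - T(b) = a
    (b + 1). *)
Lemma path_value_marginalD J i : i \in D -> i \notin J ->
  path_value (i |: J) - path_value J = loday J i.
Proof.
move=> iD iJ; rewrite /loday /path_value.
have -> : (i |: J) :\: D = J :\: D.
  by apply/setP => j; rewrite !inE; case: eqVneq => // ->; rewrite iD.
have iP : lab i \notin path_of D (i |: J) by rewrite lab_path iD setU11.
rewrite (path_ofD iD iJ) pred_in_setU1 ?ord0_path ?lab_gt0 //.
rewrite succ_in_setU1 ?ord_max_path ?lab_lt //.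
rewrite path_sum_setU1 ?ord0_path ?ord_max_path // /triangular (head_count_labD iD).
by field.
Qed.

(** An edge of size a + b splits into edges of sizes a + n + 1 and b, and T(a + n + 1) + T(b) - T(a
    + b) - T(n) = n + 1 - a (b - n - 1). *)
Lemma path_value_marginalU J i : i \notin D -> i \notin J ->
  path_value (i |: J) - path_value J = n.+1%:R - loday J i.
Proof.
move=> iD iJ; rewrite /loday /path_value.
have -> : (i |: J) :\: D = i |: (J :\: D).
  by apply/setP => j; rewrite !inE; case: eqVneq => // ->; rewrite iD.
rewrite cardsU1 !inE iD (negPf iJ) /= natrD.
have iP : lab i \notin path_of D J by rewrite lab_path (negPf iD).
rewrite (path_ofU iD iJ).
rewrite path_sum_setU1 ?ord0_path ?ord_max_path // /triangular (head_count_labU iD).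
by rewrite -natr1; field.
Qed.

(** Both factors of [loday] grow with the set. They are non-negative for i in D, so the product
    grows; they are non-positive for i in U, so the product decreases, and it is subtracted
    there. *)
Lemma path_value_marginal_incr J K i : J \subset K -> i \notin K ->
  path_value (i |: J) - path_value J <= path_value (i |: K) - path_value K.
Proof.
move=> JK iK; have iJ : i \notin J := contra (subsetP JK _) iK.
have al_JK := tail_count_pred_le JK (lab_gt0 i).
have be_JK := head_count_succ_le JK (lab_lt i).
have [pJ pJi _] := pred_inP (ord0_path D J) (lab_gt0 i).
have [pK pKi _] := pred_inP (ord0_path D K) (lab_gt0 i).
have [sJ sJi _] := succ_inP (ord_max_path D J) (lab_lt i).
have [sK sKi _] := succ_inP (ord_max_path D K) (lab_lt i).
have alJ := tail_count_le (ltnW pJi); have alK := tail_count_le (ltnW pKi).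
have beJ := head_count_le (ltnW sJi); have beK := head_count_le (ltnW sKi).
case: (boolP (i \in D)) => iD.
  rewrite (path_value_marginalD iD iJ) (path_value_marginalD iD iK) /loday.
  rewrite lab_Dbar iD in alJ alK beJ beK; move: al_JK be_JK alJ alK beJ beK.
  set a := tail_count _; set a1 := tail_count _; set a2 := tail_count _;
  set b := head_count _; set b1 := head_count _.
  set b2 := head_count _; clearbody a a1 a2 b b1 b2; clear => *; nra.
rewrite (path_value_marginalU iD iJ) (path_value_marginalU iD iK) /loday.
rewrite lab_Dbar (negPf iD) in alJ alK beJ beK; move: al_JK be_JK alJ alK beJ beK.
set a := tail_count _; set a1 := tail_count _; set a2 := tail_count _;
  set b := head_count _; set b1 := head_count _.
set b2 := head_count _; clearbody a a1 a2 b b1 b2; clear => *; nra.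
Qed.

(** The linear function (n + 1) t / 2 agrees with T at 0 and at n. Subtracting it on each edge makes
    the edges with R_vw empty or full contribute nothing; [path_sum_weights] with unit weights
    computes what was subtracted. *)
Lemma path_valueE J : path_value J = n.+1%:R / 2 * #|J|%:R +
  path_sum (fun v w => triangular #|Rdiag D (~: D) v w|%:R
              - n.+1%:R / 2 * #|Rdiag D (~: D) v w|%:R) (path_of D J).
Proof.
have := path_sum_weights D (fun=> 1 : R) J; rewrite !sumr_const card_ord => cardE.
rewrite /path_sum sumrB -mulr_sumr.
rewrite [X in _ - _ * X](_ : _ = #|J|%:R + #|J :\: D|%:R * n%:R); last first.
  by rewrite -cardE; apply: eq_bigr => v _; rewrite sumr_const.
rewrite [X in _ + (X - _)](_ : _ =
    path_sum (fun v w => triangular (head_count w - tail_count v)) (path_of D J)).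
  by rewrite /path_value /triangular -natr1; field.
apply: (@eq_path_sum R _ (fun v w => triangular #|Rdiag D (~: D) v w|%:R)); first exact: ord_max_path.
by move=> v w [_ _ vw _]; rewrite card_Rdiag.
Qed.

(** * Path values of the empty set, of [n] and of R_vw *)

Lemma triangular_trivial v w : Rdiag D (~: D) v w = set0 \/ Rdiag D (~: D) v w = setT ->
  triangular #|Rdiag D (~: D) v w|%:R - n.+1%:R / 2 * #|Rdiag D (~: D) v w|%:R = 0.
Proof. by case=> ->; rewrite ?cards0 ?cardsT ?card_ord /triangular -?natr1; field. Qed.

Lemma path_value_trivial J :
  (forall v w, step (path_of D J) v w ->
     Rdiag D (~: D) v w = set0 \/ Rdiag D (~: D) v w = setT) ->
  path_value J = n.+1%:R / 2 * #|J|%:R.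
Proof.
move=> triv; rewrite path_valueE /path_sum big1 ?addr0 // => v vP.
by apply/triangular_trivial/triv; apply: step_succ_in (ord_max_path D J) vP.
Qed.

Lemma path_value_Rdiag_step v w : let J := Rdiag D (~: D) v w in
  step (path_of D J) v w ->
  (forall v' w', step (path_of D J) v' w' -> ~ (v' = v /\ w' = w) ->
     Rdiag D (~: D) v' w' = set0 \/ Rdiag D (~: D) v' w' = setT) ->
  path_value J = triangular #|J|%:R.
Proof.
move=> J [vP wP vw no] triv; rewrite path_valueE /path_sum.
have vPm : v \in path_of D J :\ ord_max.
  rewrite in_setD1 vP andbT; apply: contraTneq vw => ->.
  by rewrite -leqNgt -ltnS ltn_ord.
rewrite (big_setD1 v vPm) /= (@succ_in_eq _ _ v w) ?ord_max_path // big1 ?addr0.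
  by rewrite addrC subrK.
move=> v' /setD1P[v'v v'P].
apply: triangular_trivial; apply: triv; first exact: step_succ_in (ord_max_path D J) v'P.
by move=> [v'E _]; rewrite v'E eqxx in v'v.
Qed.

(** The path runs along the lower boundary, through all of D, so each edge has an empty R_vw. *)
Lemma path_value0 : path_value set0 = 0.
Proof.
rewrite path_value_trivial ?cards0 ?mulr0 // => v w [vP wP vw no]; left.
have on_D u : u \in path_of D set0 -> u \in Dbar D.
  case: (labelP u) => [->|->|i ->]; rewrite ?ord0_Dbar ?ord_max_Dbar //.
  by rewrite lab_path lab_Dbar inE addbF.
rewrite /Rdiag !on_D //; apply/setP => i; rewrite !inE; apply/negP => /andP[iD].
by apply: no; rewrite lab_path iD inE.
Qed.

(** The path runs along the upper boundary, through all of U, so each edge has R_vw equal to [n]. *)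
Lemma path_valueT : path_value setT = triangular n%:R.
Proof.
rewrite path_value_trivial ?cardsT ?card_ord /triangular; first by rewrite -natr1; field.
move=> v w [vP wP vw no]; right; apply/setP => i.
have : (i \in D) || ~~ (v < lab i < w)%N.
  by case: (boolP (i \in D)) => // iD; apply/negP; apply: no; rewrite lab_path (negPf iD) inE.
have : (0 < lab i < n.+1)%N by rewrite lab_gt0 lab_lt.
have : (w <= n.+1)%N by rewrite -ltnS ltn_ord.
have end_D u : u \in path_of D setT ->
    ~~ (u \in Dbar D) || (u == 0 :> nat)%N || (u == n.+1 :> nat).
  case: (labelP u) => [->|->|j ->]; rewrite ?eqxx ?orbT //.
  by rewrite lab_path lab_Dbar inE addbT => ->.
move: vw (end_D v vP) (end_D w wP); rewrite /Rdiag.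
case: (v \in Dbar D); case: (w \in Dbar D); rewrite ?inE; case: (i \in D);
  clear; lia.
Qed.

(** For [v < w] this path follows the boundary of the polygon from 0 to [v], takes the segment from
    [v] to [w], and follows the boundary again up to n + 1. *)
Lemma path_Rdiag v w u : u \in path_of D (Rdiag D (~: D) v w) =
  match v \in Dbar D, w \in Dbar D with
  | true, true => (u \in Dbar D) && ~~ (v < u < w)%N
  | true, false =>
      if u \in Dbar D then (u <= v)%N || (u == n.+1 :> nat) else (w <= u)%N
  | false, true =>
      if u \in Dbar D then (w <= u)%N || (u == 0 :> nat)%N else (u <= v)%N
  | false, false =>
      if u \in Dbar D then (u == 0 :> nat)%N || (u == n.+1 :> nat)
      else (u <= v)%N || (w <= u)%N
  end.
Proof.
have v_le : (v <= n.+1)%N by rewrite -ltnS ltn_ord.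
have w_le : (w <= n.+1)%N by rewrite -ltnS ltn_ord.
case: (labelP u) => [->|->|i ->].
- rewrite ord0_path ord0_Dbar; move: v_le w_le.
  by case: (v \in Dbar D); case: (w \in Dbar D); clear => /=; lia.
- rewrite ord_max_path ord_max_Dbar; move: v_le w_le.
  by case: (v \in Dbar D); case: (w \in Dbar D); clear => /=; lia.
rewrite lab_path lab_Dbar /Rdiag.
have := lab_lt i; have := lab_gt0 i.
case: (v \in Dbar D); case: (w \in Dbar D); rewrite ?inE; case: (i \in D);
  clear; lia.
Qed.

Lemma path_value_Rdiag v w : (v < w)%N ->
  path_value (Rdiag D (~: D) v w) = triangular #|Rdiag D (~: D) v w|%:R.
Proof.
move=> vw; have v_le : (v <= n.+1)%N by rewrite -ltnS ltn_ord.
have w_le : (w <= n.+1)%N by rewrite -ltnS ltn_ord.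
have vP : v \in path_of D (Rdiag D (~: D) v w).
  by rewrite path_Rdiag; move: vw; clear; case: (v \in Dbar D); case: (w \in Dbar D); lia.
have wP : w \in path_of D (Rdiag D (~: D) v w).
  by rewrite path_Rdiag; move: vw; clear; case: (v \in Dbar D); case: (w \in Dbar D); lia.
apply: path_value_Rdiag_step.
  split=> // u; rewrite path_Rdiag; move: vw v_le w_le.
  by case: (v \in Dbar D); case: (w \in Dbar D); case: (u \in Dbar D); clear; lia.
move=> v' w' [v'P w'P v'w' no] neq.
have {}neq : (v' != v :> nat) || (w' != w :> nat).
  rewrite -negb_and; apply/negP => /andP[/eqP/val_inj v'v /eqP/val_inj w'w].
  exact: neq.
have no_v : ~~ (v' < v < w')%N by apply/negP; apply: no.
have no_w : ~~ (v' < w < w')%N by apply/negP; apply: no.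
have v'_le : (v' <= n.+1)%N by rewrite -ltnS ltn_ord.
have w'_le : (w' <= n.+1)%N by rewrite -ltnS ltn_ord.
(* An edge other than [vw] is a boundary edge: a lower one has both ends in [Dbar D] and an empty
   set, an upper one has the full set. *)
suff -> : Rdiag D (~: D) v' w' =
          if (v' \in Dbar D) && (w' \in Dbar D) then set0 else setT.
  by case: ifP; [left | right].
apply/setP => i.
have no_i : ~~ (lab i \in path_of D (Rdiag D (~: D) v w)) || ~~ (v' < lab i < w')%N.
  rewrite -negb_and; apply/negP => /andP[iP]; exact: no.
move: neq no_v no_w no_i v'P w'P v'w' vw (lab_gt0 i) (lab_lt i) v_le w_le v'_le w'_le.
rewrite !path_Rdiag lab_Dbar /Rdiag.
case: (v \in Dbar D); case: (w \in Dbar D); case: (v' \in Dbar D);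
  case: (w' \in Dbar D); rewrite ?inE; case: (i \in D); clear; lia.
Qed.

End Cells.

(** * Indices in enumerated, rotated and reversed lists *)

Lemma sorted_ltn_enum n (A : {set 'I_n}) : sorted (fun i j : 'I_n => i < j)%N (enum A).
Proof.
rewrite /enum_mem sorted_filter //; first by move=> i j k; apply: ltn_trans.
rewrite -enumT -[sorted _ _]/(sorted (relpre val ltn) _) -sorted_map.
by rewrite val_enum_ord iota_ltn_sorted.
Qed.

Lemma index_sorted_ltn n (i : 'I_n) (s : seq 'I_n) :
  sorted (fun i j : 'I_n => i < j)%N s -> i \in s ->
  index i s = count (fun j : 'I_n => j < i)%N s.
Proof.
have lt_tr : transitive (fun i j : 'I_n => i < j)%N by move=> j k l; apply: ltn_trans.
elim: s => //= j s IH; rewrite (path_sortedE lt_tr).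
move=> /andP[/allP j_lt s_sorted]; rewrite in_cons.
have [->|ji] := eqVneq i j; last first.
  by move=> /= i_s; rewrite (IH s_sorted i_s) j_lt.
rewrite ltnn => _; apply/esym/eqP; rewrite add0n -leqn0 leqNgt -has_count.
by apply/hasPn => k /j_lt jk; rewrite -leqNgt ltnW.
Qed.

Lemma index_enum n (A : {set 'I_n}) (i : 'I_n) : i \in A ->
  index i (enum A) = #|[set j in A | (j < i)%N]|.
Proof.
move=> iA; rewrite index_sorted_ltn ?sorted_ltn_enum ?mem_enum //.
rewrite cardE -size_filter; congr size; rewrite /enum_mem -filter_predI.
by apply: eq_filter => j /=; rewrite !inE andbC.
Qed.

Lemma index_rot (T : eqType) (p : seq T) (x : T) (k : nat) :
  uniq p -> x \in p -> (k <= size p)%N ->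
  index x (rot k p) = (if k <= index x p then index x p - k
                       else index x p + size p - k)%N.
Proof.
move=> p_uniq xp kp.
have idx : index x p =
    (if x \in take k p then index x (take k p) else k + index x (drop k p))%N.
  by rewrite -{1}(cat_take_drop k p) index_cat size_takel.
have := p_uniq; rewrite -{1}(cat_take_drop k p) cat_uniq => /and3P[_ /hasPn no_take _].
have := in_take k xp; rewrite /rot index_cat size_drop.
case: (boolP (x \in drop k p)) => [xd|xd].
  by rewrite idx (negPf (no_take x xd)) leq_addr addKn.
have xt : x \in take k p by move: xp; rewrite -{1}(cat_take_drop k p) mem_cat (negPf xd) orbF.
rewrite xt {1}idx xt => ix.
by rewrite leqNgt idx xt -ix /=; move: kp; clear; lia.
Qed.

Lemma index_rev (T : eqType) (s : seq T) (x : T) :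
  uniq s -> x \in s -> index x (rev s) = (size s - (index x s).+1)%N.
Proof.
move=> s_uniq xs; have ltx : (index x s < size s)%N by rewrite index_mem.
have lt_rev : (size s - (index x s).+1 < size s)%N by move: ltx; clear; lia.
set k := (size s - _)%N in lt_rev *.
have xE : nth x (rev s) k = x.
  rewrite nth_rev // (_ : size s - k.+1 = index x s)%N ?nth_index //.
  by rewrite /k; move: ltx; clear; lia.
by rewrite -{1}xE index_uniq ?size_rev ?rev_uniq.
Qed.

(** * Positions of the labels on the polygon *)

Section Polygon.

Variables (R : realFieldType) (n : nat) (D : {set 'I_n}).
Implicit Types (u v w a b : 'I_n.+2) (i : 'I_n).

Local Notation Q := (polygon D (~: D)).
Local Notation al := (@tail_count R n D).
Local Notation be := (@head_count R n D).

Definition polygon_index (v : 'I_n.+2) : nat := index v Q.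

Lemma mem_polygon v : v \in Q.
Proof.
rewrite /polygon in_cons mem_cat in_cons mem_rev.
case: (labelP v) => [->|->|i ->]; rewrite ?eqxx ?orbT //.
rewrite !(mem_map (@lab_inj n)) !mem_enum inE.
by case: (i \in D); rewrite ?orbT.
Qed.

Lemma size_polygon : size Q = n.+2.
Proof.
rewrite /polygon /= size_cat /= size_rev !size_map -!cardE addnS.
by rewrite cardsC card_ord.
Qed.

Lemma uniq_polygon : uniq Q.
Proof.
apply: leq_size_uniq (enum_uniq 'I_n.+2) _ _ => [v _|]; first exact: mem_polygon.
by rewrite size_polygon -cardE card_ord.
Qed.

Lemma polygon_index_lt v : (polygon_index v < n.+2)%N.
Proof. by rewrite -size_polygon index_mem mem_polygon. Qed.

Lemma polygon_index_inj : injective polygon_index.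
Proof. by move=> v w /(congr1 (nth v Q)); rewrite !nth_index ?mem_polygon. Qed.

Lemma polygon_index0 : polygon_index ord0 = 0%N.
Proof. by []. Qed.

Lemma card_lt_lab (A : {set 'I_n}) (i : 'I_n) :
  \sum_(j in A | (lab j < lab i)%N) 1 = #|[set j in A | (j < i)%N]|%:R :> R.
Proof.
rewrite sumr_const; congr (_ *+ _); apply: eq_card => j.
by rewrite !inE [in LHS]unfold_in !lab_val ltnS.
Qed.

(** The extra 1 is the vertex 0. For [v] in U, the list meets n + 1 before [v] but not [v] itself,
    whereas [head_count] counts [v] and not n + 1. *)
Lemma polygon_index_head v : v != ord0 -> (polygon_index v)%:R = be v + 1.
Proof.
case: (labelP v) => [->|->|i ->]; rewrite ?eqxx // => _.
  have -> : be ord_max = #|D|%:R.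
    rewrite /head_count /head_weight ord_max_Dbar -sumr_const; apply: eq_bigl => i.
    by rewrite lab_val ltnS ltn_ord andbT.
  rewrite /polygon_index /polygon /= index_cat (_ : ord_max \in _ = false).
    by rewrite /= eqxx addn0 size_map -cardE -natr1.
  by apply/mapP => -[i _ /eqP]; rewrite eq_sym (negPf (lab_neq_max i)).
rewrite /polygon_index /polygon /= index_cat (mem_map (@lab_inj n)) mem_enum.
rewrite /head_count /head_weight lab_Dbar; case: (boolP (i \in D)) => iD.
  by rewrite index_map ?index_enum ?card_lt_lab -?natr1 //; apply: lab_inj.
rewrite /= eq_sym (negPf (lab_neq_max i)).
have iU : i \in ~: D by rewrite inE.
rewrite index_rev ?(map_inj_uniq (@lab_inj n)) ?enum_uniq ?(mem_map (@lab_inj n)) ?mem_enum //.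
rewrite !size_map (index_map (@lab_inj n)) index_enum // -!cardE.
have -> : \sum_(j in ~: D | (lab i <= lab j)%N) 1 = #|[set j in ~: D | (i <= j)%N]|%:R :> R.
  rewrite sumr_const; congr (_ *+ _); apply: eq_card => j.
  by rewrite !inE [in LHS]unfold_in !inE !lab_val ltnS.
have cardU : #|~: D| = (#|[set j in ~: D | (j < i)%N]| + #|[set j in ~: D | (i <= j)%N]|)%N.
  rewrite -cardsUI (_ : _ :&: _ = set0) ?cards0 ?addn0; last first.
    by apply/setP => j; rewrite !inE; case: ltnP => //=; rewrite ?andbF.
  by apply: eq_card => j; rewrite !inE; case: ltnP; rewrite ?andbT ?andbF ?orbF.
have : (0 < #|[set j in ~: D | (i <= j)%N]|)%N.
  by apply/card_gt0P; exists i; rewrite !inE iD leqnn.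
rewrite sumr_const -natrD natr1 => ge_gt0; congr (_%:R).
rewrite cardU; move: ge_gt0; set l := #|_|; set g := #|_|; clear; lia.
Qed.

(** On U the tail count is minus the number of edges from 0 to [v] going clockwise, whence the shift
    by the n + 2 edges of the polygon. *)
Lemma polygon_index_tail v : v != ord_max ->
  al v = (polygon_index v)%:R - (if v \in Dbar D then 0 else n.+2%:R).
Proof.
case: (labelP v) => [->|->|i ->]; rewrite ?eqxx //.
  rewrite polygon_index0 ord0_Dbar subr0 /tail_count /tail_weight ord0_Dbar big1 // => i /andP[_].
  by rewrite lab_val.
move=> _; rewrite (polygon_index_head (lab_neq0 i)) lab_Dbar; case: (boolP (i \in D)) => iD.
  by rewrite head_count_labD // subrK subr0.
by rewrite head_count_labU // -[n.+2]addn1 natrD; ring.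
Qed.

End Polygon.

Section PolygonOrder.

Variables (n : nat) (D : {set 'I_n}).
Implicit Types (u v w a b : 'I_n.+2) (i : 'I_n).
Local Notation Q := (polygon D (~: D)).
Local Notation pos := (polygon_index D).

(** Monotonicity of head counts, read in [rat], made strict by the injectivity of positions. *)
Lemma polygon_index_mono v w : (v < w)%N ->
  if v \in Dbar D then (pos v < pos w)%N else (pos w < pos v)%N.
Proof.
move=> vw; have vw_neq : pos v != pos w.
  by apply: contraTneq vw => /polygon_index_inj ->; rewrite ltnn.
have w0 : w != ord0 by apply: contraTneq vw => ->.
have [v0|v0] := eqVneq v ord0.
  by move: vw_neq; rewrite v0 ord0_Dbar polygon_index0 ltn_neqAle leq0n andbT.
have := head_count_le rat D (ltnW vw).
have -> : head_count rat D v = (pos v)%:R - 1 by rewrite polygon_index_head // addrK.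
have -> : head_count rat D w = (pos w)%:R - 1 by rewrite polygon_index_head // addrK.
by case: ifP => _; rewrite lerD2r ler_nat ltn_neqAle 1?eq_sym ?vw_neq // eq_sym vw_neq.
Qed.

(** |R_vw| is the number of polygon vertices met strictly between [v] and [w] going
    counter-clockwise; for [v] in U this walk passes through the vertex 0. *)
Lemma card_Rdiag_index v w : (v < w)%N ->
  (#|Rdiag D (~: D) v w| + (pos v).+1 =
   pos w + if v \in Dbar D then 0 else n.+2)%N.
Proof.
move=> vw; have w0 : w != ord0 by apply: contraTneq vw => ->.
have v_max : v != ord_max.
  by apply: contraTneq vw => ->; rewrite -leqNgt -ltnS ltn_ord.
apply/eqP; rewrite -(eqr_nat rat) !natrD -natr1 card_Rdiag // (polygon_index_tail _ _ v_max).
rewrite (polygon_index_head _ _ w0); case: (v \in Dbar D); apply/eqP; ring.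
Qed.

Lemma polygon_index_next v w : next Q v = w ->
  pos w = (if (pos v).+1 == n.+2 then 0 else (pos v).+1)%N.
Proof.
rewrite next_nth mem_polygon; have := polygon_index_lt D v; have := size_polygon D.
rewrite -/(pos v); case: eqP => [posv sQ _ <-|posv sQ lt_v <-].
  rewrite -[RHS](polygon_index0 D); congr (polygon_index D _).
  by apply: (@nth_default _ _ (behead Q)); rewrite size_behead sQ; case: posv => ->.
rewrite /polygon_index -[RHS](index_uniq ord0 _ (uniq_polygon D)) // sQ -/(pos v).
by move: posv lt_v; clear; lia.
Qed.

(** Adjacent positions differ by one modulo n + 2, so either 0 or n vertices lie strictly
    between. *)
Lemma Rdiag_adjacent v w : (v < w)%N -> boundary_adjacent D (~: D) v w ->
  Rdiag D (~: D) v w = set0 \/ Rdiag D (~: D) v w = setT.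
Proof.
move=> vw adj; have cardE := card_Rdiag_index vw.
have card_le : (#|Rdiag D (~: D) v w| <= n)%N by rewrite -[leqRHS]card_ord max_card.
have [v_lt w_lt] := (polygon_index_lt D v, polygon_index_lt D w).
suff [R0|RT] : #|Rdiag D (~: D) v w| = 0%N \/ #|Rdiag D (~: D) v w| = n.
- by left; apply: cards0_eq.
- right; apply/eqP; rewrite eqEcard subsetT cardsT card_ord /=.
  by rewrite RT.
have : (pos w = if (pos v).+1 == n.+2 then 0 else (pos v).+1)%N \/
       (pos v = if (pos w).+1 == n.+2 then 0 else (pos w).+1)%N.
  by case/orP: adj => /eqP/polygon_index_next posE; [left | right].
by move: cardE card_le v_lt w_lt; case: (v \in Dbar D); clear; do 2 case: eqP; lia.
Qed.

Definition polygon_dist (v w : 'I_n.+2) : nat :=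
  if (pos v <= pos w)%N then (pos w - pos v)%N else (pos w + n.+2 - pos v)%N.

Lemma index_rot_polygon v w : index w (rot (index v Q) Q) = polygon_dist v w.
Proof. by rewrite index_rot ?uniq_polygon ?mem_polygon ?index_size // size_polygon. Qed.

Lemma size_arc_polygon v w : size (arc Q v w) = polygon_dist v w.
Proof. by rewrite /arc size_takel ?index_size // index_rot_polygon. Qed.

Lemma mem_arc_polygon u v w : (u \in arc Q v w) = (polygon_dist v u < polygon_dist v w)%N.
Proof. by rewrite /arc in_take ?mem_rot ?mem_polygon // !index_rot_polygon. Qed.

Lemma mem_labD i : (lab i \in labD D) = (i \in D).
Proof. exact: mem_imset (@lab_inj n). Qed.

End PolygonOrder.

(** * Signed lengths as differences of counts *)

Section SignedLengths.

Variables (R : realFieldType) (n : nat) (D : {set 'I_n}).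
Implicit Types (a b : 'I_n.+2) (i : 'I_n).
Local Notation al := (@tail_count R n D).
Local Notation be := (@head_count R n D).
Local Notation pos := (polygon_index D).

(** For i in D the path avoiding [b] goes counter-clockwise from [a] to i and counts negatively. For
    i in U it goes clockwise through 0, which accounts for the n + 2 in the tail count of i. *)
Lemma signed_length_below a b i :
  a \in Dbar D -> b \in Dbar D -> (a < lab i < b)%N ->
  (signed_length D (~: D) a (lab i) b)%:~R = al a - al (lab i).
Proof.
move=> aD bD /andP[ai ib]; have ab := ltn_trans ai ib.
have a_max : a != ord_max.
  by apply: contraTneq ab => ->; rewrite -leqNgt -ltnS ltn_ord.
have := polygon_index_mono D ab; have := polygon_index_mono D ai.
have := polygon_index_mono D ib; have := polygon_index_lt D (lab i).
have := polygon_index_lt D b.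
rewrite !polygon_index_tail ?lab_neq_max // aD subr0 /signed_length mem_labD /boundary_length_avoiding.
rewrite mem_arc_polygon !size_arc_polygon /polygon_dist lab_Dbar.
case: (boolP (i \in D)) => iD b_lt i_lt i_b a_i a_b.
  rewrite (ltnW a_i) (ltnW a_b) ltn_sub2rE 1?ltnNge ?(ltnW i_b) //=; last exact: ltnW.
  by rewrite subr0 mulrNz -pmulrn natrB ?opprB // ltnW.
rewrite (ltnW a_i) (ltnW a_b) ltn_sub2rE ?i_b //; last exact: ltnW.
rewrite leqNgt a_i -pmulrn natrB; last by move: i_lt; clear; lia.
by rewrite natrD; ring.
Qed.

(** Here the path avoiding [a] never passes through 0, so both lengths are plain differences of
    positions. *)
Lemma signed_length_above a b i :
  a \in Dbar D -> b \in Dbar D -> (a < lab i < b)%N ->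
  (signed_length D (~: D) b (lab i) a)%:~R = be (lab i) - be b.
Proof.
move=> aD bD /andP[ai ib]; have ab := ltn_trans ai ib.
have b0 : b != ord0 by apply: contraTneq ab => ->.
have beE v : v != ord0 -> be v = (pos v)%:R - 1 by move=> v0; rewrite polygon_index_head // addrK.
have := polygon_index_mono D ab; have := polygon_index_mono D ai.
have := polygon_index_mono D ib; have := polygon_index_lt D (lab i).
have := polygon_index_lt D b.
rewrite !beE ?lab_neq0 // aD /signed_length mem_labD /boundary_length_avoiding.
rewrite mem_arc_polygon !size_arc_polygon /polygon_dist lab_Dbar.
case: (boolP (i \in D)) => iD b_lt i_lt i_b a_i a_b.
  rewrite (leqNgt (pos b) (pos a)) a_b (leqNgt (pos b) (pos (lab i))) i_b /=.
  rewrite ifT; last by move: a_b a_i i_b b_lt; clear; lia.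
  by rewrite (ltnW i_b) mulrNz -pmulrn natrB ?(ltnW i_b) //; ring.
rewrite (leqNgt (pos b) (pos a)) a_b (ltnW i_b) /=.
rewrite ifF; last by move: a_b a_i i_b i_lt; clear; lia.
by rewrite -pmulrn natrB ?(ltnW i_b) //; ring.
Qed.

End SignedLengths.

(** * The tight right-hand sides z_J *)

Section Tight.

Variables (R : realType) (n : nat) (D : {set 'I_n}).
Implicit Types (J : {set 'I_n}) (x : 'rV[R]_n).

Lemma triangular_nat (k : nat) : triangular k%:R = (k * k.+1)%:R / 2 :> R.
Proof. by rewrite /triangular natrM natr1. Qed.

(* A boundary edge vw has no inequality in the definition of the associahedron,
   but its R_vw is empty or [n]. *)
Lemma path_value_le_sum x J : associahedron R D (~: D) x ->
  path_value R D J <= \sum_(i in J) x 0 i.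
Proof.
move=> [xT xR]; have xT' : \sum_i x 0 i = triangular n%:R by rewrite triangular_nat.
(* Adding and subtracting |J \ D| times the total turns x(J) into the path sum of the x(R_vw), which
   is then bounded edge by edge. *)
rewrite -[leRHS](addrK (#|J :\: D|%:R * triangular n%:R)) -{1}xT'.
rewrite -(path_sum_weights D (fun i => x 0 i)) /path_value lerD2r.
apply: ler_path_sum; first exact: ord_max_path.
move=> v w [_ _ vw _]; rewrite -card_Rdiag //.
case: (boolP (boundary_adjacent D (~: D) v w)) => [/(Rdiag_adjacent vw)|adj].
  case=> ->; first by rewrite cards0 big_set0 /triangular mul0r mul0r.
  rewrite cardsT card_ord -xT' le_eqVlt; apply/orP; left; apply/eqP.
  by apply: eq_bigl => i; rewrite inE.
rewrite triangular_nat; apply: xR => //; rewrite /proper_diagonal adj andbT.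
by apply: contraTneq vw => ->; rewrite ltnn.
Qed.

(** A greedy point tight at [J] and at [n] lies in the associahedron, because the bound for R_vw is
    the path value of R_vw. *)
Lemma path_value_attained J : exists2 x, associahedron R D (~: D) x &
  \sum_(i in J) x 0 i = path_value R D J.
Proof.
have [y [yR yJ yT]] := greedy_tight (path_value0 R D) (@path_value_marginal_incr R n D) (subsetT J).
have rowE A : \sum_(i in A) (\row_i y i) 0 i = \sum_(i in A) y i.
  by apply: eq_bigr => i _; rewrite mxE.
exists (\row_i y i); last by rewrite rowE.
split.
  rewrite -triangular_nat -(path_valueT R D) -yT -rowE; apply: eq_bigl => i; by rewrite inE.
move=> v w vw _; rewrite -triangular_nat -path_value_Rdiag // rowE; apply: yR.
exact: subsetT.
Qed.

Lemma tight_rhsE J : tight_rhs R D (~: D) J = path_value R D J.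
Proof.
rewrite /tight_rhs; case: eqVneq => [->|_]; first by rewrite path_value0.
apply: xget_unique => [|m [[x xAs <-] m_lb]].
  split; last by move=> _ [x xAs <-]; apply: path_value_le_sum.
  by have [x xAs xJ] := path_value_attained J; exists x.
have [y yAs yJ] := path_value_attained J.
apply/eqP; rewrite eq_le path_value_le_sum // andbT -yJ; apply: m_lb.
by exists y.
Qed.

End Tight.

(** * Alternating sums as iterated differences *)

Lemma mobius_split (R : comNzRingType) (T : finType) (f : {set T} -> R)
    (I : {set T}) (i : T) : i \in I ->
  \sum_(J : {set T} | J \subset I) (-1) ^+ #|I :\: J| * f J =
  \sum_(S : {set T} | S \subset I :\ i)
    (-1) ^+ #|(I :\ i) :\: S| * (f (i |: S) - f S).
Proof.
move=> iI; rewrite (bigID (fun J : {set T} => i \in J)) /=.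
rewrite (reindex_onto (fun S => i |: S) (fun J => J :\ i)) /=; last first.
  by move=> J /andP[_ iJ]; rewrite setD1K.
have -> : \sum_(S | ((i |: S \subset I) && (i \in i |: S)) && ((i |: S) :\ i == S))
            (-1) ^+ #|I :\: (i |: S)| * f (i |: S) =
          \sum_(S : {set T} | S \subset I :\ i) (-1) ^+ #|(I :\ i) :\: S| * f (i |: S).
  apply: eq_big => [S|S _].
    rewrite subUset sub1set iI setU11 andbT subsetD1 /=; congr (_ && _).
    apply/eqP/idP => [<-|iS]; first by rewrite setD11.
    by rewrite setU1K.
  by rewrite setDDl setUC setUC.
have -> : \sum_(J : {set T} | (J \subset I) && (i \notin J)) (-1) ^+ #|I :\: J| * f J =
          \sum_(S : {set T} | S \subset I :\ i) - ((-1) ^+ #|(I :\ i) :\: S| * f S).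
  apply: eq_big => [S|S /andP[_ iS]]; first by rewrite subsetD1.
  rewrite (cardsD1 i) !inE iS iI setDDl setUC -setDDl exprS mulN1r mulNr.
  by [].
by rewrite -big_split; apply: eq_bigr => S _; rewrite mulrBr.
Qed.

Section Moebius.

Variables (R : realFieldType) (n : nat) (D : {set 'I_n}).
Implicit Types (I J S : {set 'I_n}) (i c d e : 'I_n) (a b u v w : 'I_n.+2).
Local Notation al := (@tail_count R n D).
Local Notation be := (@head_count R n D).

Lemma path_setU1 i S v : v != lab i ->
  (v \in path_of D (i |: S)) = (v \in path_of D S).
Proof.
case: (labelP v) => [->|->|j ->]; rewrite ?ord0_path ?ord_max_path //.
by rewrite !lab_path (inj_eq (@lab_inj n)) in_setU1 => /negPf->.
Qed.

Lemma pred_in_setU1_above c d S : (c < d)%N ->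
  pred_in (path_of D (d |: S)) (lab c) = pred_in (path_of D S) (lab c).
Proof.
move=> cd; have [pP pc p_max] := pred_inP (ord0_path D S) (lab_gt0 c).
have below v : (v <= lab c)%N -> v != lab d.
  by move=> vc; apply: contraTneq vc => ->; rewrite -ltnNge !lab_val ltnS.
apply: pred_in_eq => //; first exact: ord0_path.
  by rewrite path_setU1 // below // ltnW.
move=> u; case: (leqP u (lab c)) => uc; last by rewrite (ltnNge u) (ltnW uc) andbF.
rewrite path_setU1 ?below // => uP /andP[pu u_lt].
by have := p_max u uP u_lt; rewrite leqNgt pu.
Qed.

(** A path vertex [e] between [c] and [d] shields the neighbours of [c] from any change at [d]. *)
Lemma loday_setU1_above c d e S : (c < e < d)%N -> lab e \in path_of D S ->
  loday R D (d |: S) c = loday R D S c.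
Proof.
move=> /andP[ce ed] eP; rewrite /loday (pred_in_setU1_above S (ltn_trans ce ed)).
have [sP cs s_min] := succ_inP (ord_max_path D S) (lab_lt c).
have ce' : (lab c < lab e)%N by rewrite !lab_val ltnS.
have se := s_min _ eP ce'.
have below v : (v <= lab e)%N -> v != lab d.
  by move=> vc; apply: contraTneq vc => ->; rewrite -ltnNge !lab_val ltnS.
rewrite (@succ_in_eq _ (path_of D (d |: S)) (lab c) (succ_in (path_of D S) (lab c))) //.
- exact: ord_max_path.
- by rewrite path_setU1 // below.
move=> u uP /andP[cu us].
have uP' : u \in path_of D S by rewrite -(@path_setU1 d) // below // ltnW // (leq_trans us).
by have := s_min u uP' cu; rewrite leqNgt us.
Qed.

Definition upper_sign i : R := (-1) ^+ (i \notin D).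

Definition first_diff c S : R := path_value R D (c |: S) - path_value R D S.

Lemma first_diffE c S : c \notin S ->
  first_diff c S = upper_sign c * loday R D S c + (c \notin D)%:R * n.+1%:R.
Proof.
move=> cS; rewrite /first_diff /upper_sign; case: (boolP (c \in D)) => cD.
  by rewrite path_value_marginalD //= expr0; ring.
by rewrite path_value_marginalU //= expr1; ring.
Qed.

Definition mobius I : R :=
  \sum_(J : {set 'I_n} | J \subset I) (-1) ^+ #|I :\: J| * path_value R D J.

(** The constant n + 1 in the first difference at an upper [c] does not depend on the set, so it
    cancels in the second difference. *)
Lemma mobius_second_diff I c d : c \in I -> d \in I -> (c < d)%N ->
  mobius I = \sum_(S : {set 'I_n} | S \subset I :\ c :\ d)
    (-1) ^+ #|(I :\ c :\ d) :\: S| *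
      (upper_sign c * (loday R D (d |: S) c - loday R D S c)).
Proof.
move=> cI dI cd; have dc : d != c by rewrite -val_eqE /= gtn_eqF.
rewrite /mobius (mobius_split _ cI) (@mobius_split _ _ (first_diff c) _ d).
  apply: eq_bigr => S; rewrite !subsetD1 => /andP[/andP[_ cS] dS]; congr (_ * _).
  have cdS : c \notin d |: S by rewrite in_setU1 eq_sym (negPf dc).
  by rewrite (first_diffE cdS) (first_diffE cS); ring.
by rewrite !inE dc.
Qed.

(** Being in D and not in [I], the label [e] is on the path of every subset of [I] and always
    shields [c] from [d]. *)
Lemma mobius_separated I c d e : c \in I -> d \in I -> (c < e < d)%N ->
  e \in D -> e \notin I -> mobius I = 0.
Proof.
move=> cI dI ced eD eI; have /andP[ce ed] := ced.
rewrite (mobius_second_diff cI dI (ltn_trans ce ed)) big1 // => S.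
rewrite !subsetD1 => /andP[/andP[SI _] _].
rewrite (loday_setU1_above ced) ?subrr ?mulr0 //.
by rewrite lab_path eD (negPf (contra (subsetP SI e) eI)).
Qed.

Lemma mobius_interval I c d a b : c \in I -> d \in I -> (c < d)%N ->
  (forall i, i \in I -> (c <= i <= d)%N) ->
  (forall i, i \in D -> (c < i < d)%N -> i \in I) ->
  (forall S, S \subset I -> pred_in (path_of D S) (lab c) = a) ->
  (forall S, S \subset I -> succ_in (path_of D S) (lab d) = b) ->
  mobius I = (-1) ^+ #|I :\: D| * ((al (lab c) - al a) * (be b - be (lab d))).
Proof.
move=> cI dI cd Icd DI pa sb; rewrite (mobius_second_diff cI dI cd).
have dc : d != c by rewrite -val_eqE /= gtn_eqF.
(* [S0] is the only subset of [I'] whose path has no vertex strictly between [c] and [d]: wherever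
   [S] differs from [S0], the label is on the path of [S] and shields [c]. *)
set I' := I :\ c :\ d; pose S0 := I' :&: D.
have I'P i : i \in I' -> (c < i < d)%N.
  rewrite !inE -!val_eqE /= => /and3P[id ic iI]; have := Icd i iI.
  by move: id ic; clear; lia.
have S0I : S0 \subset I' := subsetIl _ _.
have I'I : I' \subset I by rewrite /I'; apply: subset_trans (subsetDl _ _) (subsetDl _ _).
rewrite (bigD1 S0 S0I) /= [X in _ + X]big1 ?addr0; last first.
  move=> S /andP[SI' SneS0]; rewrite -/I' in SI'.
  have [e eS] : exists e, (e \in S) != (e \in S0).
    by apply/existsP; apply: contraNT SneS0; rewrite negb_exists => /forallP eqS;
       apply/eqP/setP => e; apply/eqP; rewrite -[_ == _]negbK.
  have eI' : e \in I'.
    by move: eS; case: (boolP (e \in S)) => [/(subsetP SI')//|_]; case: (boolP (e \in S0)) => // /(subsetP S0I).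
  rewrite (loday_setU1_above (I'P e eI')) ?subrr ?mulr0 //.
  by move: eS; rewrite lab_path /S0 in_setI eI' /=; case: (e \in D); case: (e \in S).
have dS0 : d \notin S0 by rewrite !inE eqxx.
have S0sub : S0 \subset I := subset_trans S0I I'I.
have dS0sub : d |: S0 \subset I by rewrite subUset sub1set dI.
have cd' : (lab c < lab d)%N by rewrite !lab_val ltnS.
have empty u : u \in path_of D S0 -> ~~ (lab c < u < lab d)%N.
  case: (labelP u) => [->|->|i ->] iP; rewrite ?andbF //.
    by apply/nandP; right; rewrite -leqNgt; apply: ltnW (lab_lt d).
  apply/negP; rewrite !lab_val !ltnS => cid; move: iP; rewrite lab_path /S0 in_setI.
  case: (boolP (i \in D)) => iD; rewrite ?andbF // andbT !inE (DI i iD cid).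
  by case/andP: cid => ci id; rewrite -!val_eqE /= (gtn_eqF ci) (ltn_eqF id).
have b_succ S : S \subset I -> [/\ b \in path_of D S, (lab d < b)%N &
    forall u, u \in path_of D S -> (lab d < u)%N -> (b <= u)%N].
  by move=> SI; rewrite -(sb S SI); apply: succ_inP (ord_max_path D S) (lab_lt d).
have succ_d S : lab d \in path_of D S ->
    (forall u, u \in path_of D S -> ~~ (lab c < u < lab d)%N) ->
    succ_in (path_of D S) (lab c) = lab d.
  by move=> dP no; apply: succ_in_eq => // [|u uP]; [exact: ord_max_path | exact/negP/no].
have succ_b S : S \subset I -> lab d \notin path_of D S ->
    (forall u, u \in path_of D S -> ~~ (lab c < u < lab d)%N) ->
    succ_in (path_of D S) (lab c) = b.
  move=> SI dP no; have [bP db b_min] := b_succ S SI.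
  apply: succ_in_eq => //; [exact: ord_max_path | exact: ltn_trans db |].
  move=> u uP /andP[cu ub]; have := no u uP; have := b_min u uP; rewrite cu /=.
  case: (ltngtP u (lab d)) => // ud; first by move=> /(_ isT); rewrite leqNgt ub.
  by move=> _ _; rewrite (val_inj ud) (negPf dP) in uP.
have empty' u : u \in path_of D (d |: S0) -> ~~ (lab c < u < lab d)%N.
  case: (eqVneq u (lab d)) => [->|ud]; first by rewrite ltnn andbF.
  by rewrite path_setU1 //; apply: empty.
(* [I' :\: S0] is the upper part of [I']; [c] and [d] supply their own signs. *)
have sign : (-1) ^+ #|I :\: D| = (-1) ^+ #|I' :\: S0| * upper_sign c * upper_sign d :> R.
  rewrite /upper_sign -!exprD; congr (_ ^+ _); rewrite /S0 setDIr setDv set0U.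
  rewrite (cardsD1 c) (cardsD1 d (_ :\ c)) !inE cI dI dc !andbT addnA addnC addnA.
  by congr (_ + _ + _)%N; apply: eq_card => i; rewrite !inE; do ?case: (_ == _); rewrite ?andbF.
rewrite sign /loday !pa //.
(* Adding [d] to [S0] moves the successor of [c] from [d] to [b] if [d] is in D, and from [b] to [d]
   if [d] is in U; this explains [upper_sign d]. *)
case: (boolP (d \in D)) => dD.
  rewrite (succ_d S0) ?(succ_b (d |: S0)) //; first by rewrite /upper_sign dD; ring.
  - by rewrite lab_path dD setU11.
  - by rewrite lab_path dD (negPf dS0).
rewrite (succ_d (d |: S0)) ?(succ_b S0) //; first by rewrite /upper_sign dD; ring.
- by rewrite lab_path (negPf dD) (negPf dS0).
- by rewrite lab_path (negPf dD) setU11.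
Qed.

(** With a single element there is only a first difference, so for an upper [c] the constant n + 1
    survives. *)
Lemma mobius1 c a b :
  pred_in (path_of D set0) (lab c) = a -> succ_in (path_of D set0) (lab c) = b ->
  mobius [set c] =
  upper_sign c * ((al (lab c) - al a) * (be b - be (lab c))) + (c \notin D)%:R * n.+1%:R.
Proof.
move=> pa sb; rewrite /mobius (mobius_split _ (set11 c)) setDv.
rewrite (big_pred1 set0) => [|S]; last by rewrite subset0.
rewrite setDv cards0 expr0 mul1r -/(first_diff c set0) first_diffE ?inE //.
by rewrite /loday pa sb [X in upper_sign c * X]mulrC.
Qed.

End Moebius.

(** * Nested components and their ends *)

Section Nested.

Variables (n : nat) (D I : {set 'I_n}).
Implicit Types (S : {set 'I_n}) (i c d e : 'I_n) (a b u v w : 'I_n.+2).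

Lemma gamma_minP i0 : i0 \in I ->
  exists c, [/\ gamma_min I = lab c, c \in I & forall j, j \in I -> (c <= j)%N].
Proof.
move=> i0I; have [c cI c_min] := @arg_minnP _ i0 (fun i => i \in I) (fun i : 'I_n => i : nat) i0I.
rewrite /gamma_min; case: pickP => [c' /andP[c'I /forall_inP c'_min]|/(_ c)].
  by exists c'.
by rewrite /= cI => /negP[]; apply/forall_inP => j jI; apply: c_min.
Qed.

Lemma Gamma_maxP i0 : i0 \in I ->
  exists d, [/\ Gamma_max I = lab d, d \in I & forall j, j \in I -> (j <= d)%N].
Proof.
move=> i0I; have [c cI c_max] := @arg_maxnP _ i0 (fun i => i \in I) (fun i : 'I_n => i : nat) i0I.
rewrite /Gamma_max; case: pickP => [c' /andP[c'I /forall_inP c'_max]|/(_ c)].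
  by exists c'.
by rewrite /= cI => /negP[]; apply/forall_inP => j jI; apply: c_max.
Qed.

Local Notation E := (Dbar D :\: [set lab i | i in I]).

Lemma ord0_ends : ord0 \in E.
Proof.
rewrite in_setD ord0_Dbar andbT; apply/imsetP => -[i _ /eqP].
by rewrite eq_sym (negPf (lab_neq0 i)).
Qed.

Lemma ord_max_ends : ord_max \in E.
Proof.
rewrite in_setD ord_max_Dbar andbT; apply/imsetP => -[i _ /eqP].
by rewrite eq_sym (negPf (lab_neq_max i)).
Qed.

Lemma lab_ends i : (lab i \in E) = (i \in D) && (i \notin I).
Proof. by rewrite in_setD lab_Dbar (mem_imset _ _ (@lab_inj n)) andbC. Qed.

Lemma consecutiveP a b : consecutive D I a b ->
  [/\ a \in E, b \in E, (a < b)%N & forall u, u \in E -> ~~ (a < u < b)%N].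
Proof. by case/and4P => aE bE ab /forall_inP no; split. Qed.

Lemma consecutive_around i : i \in I ->
  exists a b, consecutive D I a b /\ (a < lab i < b)%N.
Proof.
move=> iI; have [aE ai a_max] := pred_inP ord0_ends (lab_gt0 i).
have [bE ib b_min] := succ_inP ord_max_ends (lab_lt i).
exists (pred_in E (lab i)), (succ_in E (lab i)); rewrite ai ib; split=> //.
apply/and4P; split=> //; first exact: ltn_trans ib.
apply/forall_inP => u uE; apply/negP => /andP[au ub].
case: (ltngtP u (lab i)) => ui.
- by have := a_max u uE ui; rewrite leqNgt au.
- by have := b_min u uE ui; rewrite leqNgt ub.
- by move: uE; rewrite (val_inj ui) lab_ends iI andbF.
Qed.

Lemma nested_endsP a b : consecutive D I a b ->
  I \subset open_interval [set: 'I_n] a b ->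
  consecutive D I (nested_ends D I).1 (nested_ends D I).2 /\
  forall i, i \in I -> ((nested_ends D I).1 < lab i < (nested_ends D I).2)%N.
Proof.
move=> ab Iab; rewrite /nested_ends; case: pickP => [p /andP[pC /subsetP Ip]|/(_ (a, b))].
  by split=> // i /Ip; rewrite !inE.
by rewrite /= ab Iab.
Qed.

(** Each element of [I] lies in the component cut out by its neighbours in [E], and all these
    components coincide. *)
Lemma nested_number1 : nested_number D I = 1%N ->
  exists a b, consecutive D I a b /\ I \subset open_interval [set: 'I_n] a b.
Proof.
move/eqP/cards1P => [C CE].
have comp i : i \in I -> exists a b,
    [/\ consecutive D I a b, C = open_interval I a b & i \in C].
  move=> iI; have [a [b [ab iab]]] := consecutive_around iI.
  have iO : i \in open_interval I a b by rewrite inE iI.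
  have : open_interval I a b \in nested_components D I.
    rewrite in_setD1; apply/andP; split; first by apply/set0Pn; exists i.
    by apply/imsetP; exists (a, b); rewrite ?inE.
  by rewrite CE inE => /eqP <-; exists a, b.
have /set0Pn[C0 C0P] : nested_components D I != set0 by rewrite CE -card_gt0 cards1.
move: (C0P); rewrite in_setD1 => /andP[/set0Pn[i iC0] /imsetP[p pC C0E]].
rewrite inE in pC; exists p.1, p.2; split=> //; apply/subsetP => j jI.
have [a [b [_ _ jC]]] := comp j jI.
move: C0P jC; rewrite CE inE => /eqP <-; rewrite C0E !inE => /andP[_ ->].
by [].
Qed.

Lemma nested_number_gt1 : (2 <= nested_number D I)%N ->
  exists c d e, [/\ c \in I, d \in I, e \in D, e \notin I & (c < e < d)%N].
Proof.
move/card_gt1P => [C1 [C2 [C1P C2P C12]]].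
suff [c [d [u [cI dI uE /andP[cu ud]]]]] :
    exists c d u, [/\ c \in I, d \in I, u \in E & (lab c < u < lab d)%N].
  move: uE cu ud; case: (labelP u) => [->|->|e ->]; first by rewrite ltn0.
    by move=> _ _; rewrite ltnNge ltnW // lab_lt.
  rewrite lab_ends !lab_val !ltnS => /andP[eD eI] ce ed.
  by exists c, d, e; rewrite ce ed.
move: C1P; rewrite in_setD1 => /andP[/set0Pn[i1 iC1] /imsetP[[a1 b1] cons1 C1E]].
move: C2P; rewrite in_setD1 => /andP[/set0Pn[i2 iC2] /imsetP[[a2 b2] cons2 C2E]].
rewrite !inE /= in cons1 cons2 C1E C2E.
move: iC1; rewrite C1E !inE => /and3P[i1I ai1 ib1].
move: iC2; rewrite C2E !inE => /and3P[i2I ai2 ib2].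
have [a1E b1E ab1 no1] := consecutiveP cons1.
have [a2E b2E ab2 no2] := consecutiveP cons2.
have := no1 _ a2E; have := no1 _ b2E; have := no2 _ a1E; have := no2 _ b1E.
(* If one interval lies to the left of the other, its right end separates the two chosen elements.
   Otherwise they overlap, and as no end lies strictly inside either, they are equal. *)
case: (leqP b1 a2) => [b1a2 _ _ _ _|a2b1].
  by exists i1, i2, b1; rewrite ib1 (leq_ltn_trans b1a2 ai2).
case: (leqP b2 a1) => [b2a1 _ _ _ _|a1b2].
  by exists i2, i1, b2; rewrite ib2 (leq_ltn_trans b2a1 ai1).
move=> n1 n2 n3 n4; case/negP: C12; rewrite C1E C2E.
have /val_inj -> : a1 = a2 :> nat by move: n2 n4 a2b1 a1b2; clear; lia.
suff /val_inj -> : b1 = b2 :> nat by [].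
by move: n1 n3 a2b1 a1b2; clear; lia.
Qed.

Section OneComponent.

Variables (a b : 'I_n.+2) (c d : 'I_n).
Hypotheses (ab : consecutive D I a b)
  (Iab : forall i, i \in I -> (a < lab i < b)%N).
Hypotheses (cI : c \in I) (c_min : forall i, i \in I -> (c <= i)%N).
Hypotheses (dI : d \in I) (d_max : forall i, i \in I -> (i <= d)%N).

Lemma between_in i : i \in D -> (a < lab i < b)%N -> i \in I.
Proof.
move=> iD iab; have [_ _ _ no] := consecutiveP ab.
by apply: contraLR iab => iI; apply: no; rewrite lab_ends iD.
Qed.

Lemma ends_path u S : u \in E -> S \subset I -> u \in path_of D S.
Proof.
case: (labelP u) => [->|->|i ->]; rewrite ?ord0_path ?ord_max_path //.
rewrite lab_ends lab_path => /andP[-> iI] SI.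
by rewrite (negPf (contra (subsetP SI i) iI)).
Qed.

(** A label strictly between [a] and [c] is below min I, hence not in [S]; if it were on the path it
    would be in D, and so in [I] by [between_in]. *)
Lemma pred_in_ends S : S \subset I -> pred_in (path_of D S) (lab c) = a.
Proof.
move=> SI; have [aE _ _ _] := consecutiveP ab; have /andP[ac cb] := Iab cI.
apply: pred_in_eq => //; [exact: ord0_path | exact: ends_path |].
move=> u; case: (labelP u) => [->|->|i ->]; first by rewrite ltn0.
  by move=> _ /andP[_]; rewrite ltnNge ltnW // lab_lt.
rewrite lab_path => iP /andP[ai ic].
have iI : i \notin I by apply: contraL ic => /c_min; rewrite -leqNgt !lab_val.
move: iP; rewrite (negPf (contra (subsetP SI i) iI)) addbF => iD.
by case/negP: iI; apply: between_in => //; rewrite ai (ltn_trans ic).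
Qed.

Lemma succ_in_ends S : S \subset I -> succ_in (path_of D S) (lab d) = b.
Proof.
move=> SI; have [_ bE _ _] := consecutiveP ab; have /andP[ad db] := Iab dI.
apply: succ_in_eq => //; [exact: ord_max_path | exact: ends_path |].
move=> u; case: (labelP u) => [->|->|i ->]; first by rewrite ltn0.
  by move=> _ /andP[_]; rewrite ltnNge -ltnS ltn_ord.
rewrite lab_path => iP /andP[di ib].
have iI : i \notin I by apply: contraL di => /d_max; rewrite -leqNgt !lab_val.
move: iP; rewrite (negPf (contra (subsetP SI i) iI)) addbF => iD.
by case/negP: iI; apply: between_in => //; rewrite ib andbT (ltn_trans ad).
Qed.

Lemma setD_open_interval : I :\: open_interval D a b = I :\: D.
Proof.
apply/setP => i; rewrite !inE; case: (boolP (i \in I)) => iI; rewrite ?andbF //.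
by rewrite Iab // !andbT.
Qed.

Lemma between_min_max_in i : i \in D -> (c < i < d)%N -> i \in I.
Proof.
move=> iD /andP[ci id]; apply: between_in => //.
have /andP[ac _] := Iab cI; have /andP[_ db] := Iab dI.
by rewrite (ltn_trans ac) ?(ltn_trans _ db) // !lab_val ltnS.
Qed.

End OneComponent.

End Nested.

(** * Evaluation of the Minkowski coefficients *)

Section Coefficients.

Variables (R : realType) (n : nat) (D I : {set 'I_n}).

Lemma minkowski_coeffE : minkowski_coeff R D (~: D) I = mobius R D I.
Proof. by apply: eq_bigr => J _; rewrite tight_rhsE. Qed.

(** Each signed length is the opposite of a factor of [mobius_interval]; the two signs cancel in the
    product. *)
Lemma nested_data (i0 : 'I_n) (a0 b0 : 'I_n.+2) : i0 \in I ->
  consecutive D I a0 b0 -> I \subset open_interval [set: 'I_n] a0 b0 ->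
  exists a b c d, [/\ [/\ consecutive D I a b, nested_ends D I = (a, b) &
      forall i, i \in I -> (a < lab i < b)%N],
    (c \in I /\ forall i, i \in I -> (c <= i)%N),
    (d \in I /\ forall i, i \in I -> (i <= d)%N) &
    (K_gamma D (~: D) I * K_Gamma D (~: D) I)%:~R =
    (tail_count R D (lab c) - tail_count R D a) * (head_count R D b - head_count R D (lab d))].
Proof.
move=> i0I ab0 Iab0; have [ab Iab] := nested_endsP ab0 Iab0.
have [c [cE cI c_min]] := gamma_minP i0I.
have [d [dE dI d_max]] := Gamma_maxP i0I.
exists (nested_ends D I).1, (nested_ends D I).2, c, d; split=> //.
  by split=> //; case: nested_ends.
have [/setDP[aD _] /setDP[bD _] _ _] := consecutiveP ab.
rewrite /K_gamma /K_Gamma cE dE intrM.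
rewrite signed_length_below ?Iab // signed_length_above ?Iab //.
by ring.
Qed.

End Coefficients.

Theorem theorem4p3 (R : realType) (n : nat) (D U I : {set 'I_n})
    (n_ge2 : (2 <= n)%N) (DU : DU_partition D U) (I_neq0 : I != set0) :
  [/\ nested_number D I = 1%N ->
        ~ (exists2 u : 'I_n, u \in U & I = [set u]) ->
        minkowski_coeff R D U I =
          (-1) ^+ #|I :\: open_interval D (nested_ends D I).1 (nested_ends D I).2|
            * (K_gamma D U I * K_Gamma D U I)%:~R,
      forall u : 'I_n, u \in U -> I = [set u] ->
        minkowski_coeff R D U I =
          n.+1%:R - (K_gamma D U I * K_Gamma D U I)%:~R
    & (2 <= nested_number D I)%N -> minkowski_coeff R D U I = 0].
Proof.
have UE : U = ~: D.
  case: DU => DUT dis _ _; apply/setP => i; rewrite inE.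
  have : i \in D :|: U by rewrite DUT inE.
  rewrite inE; case: (boolP (i \in D)) => [iD _|//].
  by have := disjointFr dis iD.
have [i0 i0I] := set0Pn _ I_neq0.
rewrite {}UE minkowski_coeffE; split.
- move=> v1 not_U; have [a0 [b0 [ab0 Iab0]]] := nested_number1 v1.
  have [a [b [c [d [[ab endsE Iab] [cI c_min] [dI d_max] ->]]]]] := nested_data R i0I ab0 Iab0.
  have pa := pred_in_ends ab Iab cI c_min; have sb := succ_in_ends ab Iab dI d_max.
  rewrite endsE /= setD_open_interval //.
  have [cd|] := ltnP c d.
    apply: mobius_interval => //; first by move=> i iI; rewrite c_min ?d_max.
    by move=> i; apply: between_min_max_in ab Iab cI dI i.
  (* When min I = max I, the set is a singleton, whose element is in D since the singletons of U are
     excluded in this case. *)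
  move=> dc; have dE : d = c.
    by apply: val_inj; apply/eqP; rewrite eqn_leq dc c_min.
  have IE : I = [set c].
    apply/setP => i; rewrite inE; apply/idP/eqP => [iI|->//].
    by apply: val_inj; apply/eqP; rewrite eqn_leq c_min // -dE d_max.
  have cD : c \in D.
    by apply: contraT => cD; case: not_U; exists c; rewrite ?inE.
  have -> : I :\: D = set0.
    by apply/setP => i; rewrite IE !inE; case: eqVneq => [->|]; rewrite ?cD ?andbF.
  rewrite cards0 dE {1}IE (@mobius1 _ _ _ _ a b) /upper_sign ?cD /=; first by ring.
    by apply: pa; apply: sub0set.
  by rewrite -dE; apply: sb; apply: sub0set.
- move=> u; rewrite inE => uD IE; have uI : u \in I by rewrite IE inE.
  (* The ends around [u] enclose the whole singleton, which provides the data of the case of one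
     component. *)
  have [a0 [b0 [ab0 uab]]] := consecutive_around D uI.
  have Iab0 : I \subset open_interval [set: 'I_n] a0 b0.
    by rewrite IE sub1set !inE.
  have [a [b [c [d [[ab endsE Iab] [cI c_min] [dI d_max] ->]]]]] := nested_data R i0I ab0 Iab0.
  have cE : c = u by apply/set1P; rewrite -IE.
  have dE : d = u by apply/set1P; rewrite -IE.
  rewrite {1}IE (@mobius1 _ _ _ _ a b) /upper_sign ?uD ?cE ?dE.
  + by rewrite expr1 mulN1r mul1r addrC.
  + by rewrite -cE; apply: (pred_in_ends ab Iab cI c_min); apply: sub0set.
  + by rewrite -dE; apply: (succ_in_ends ab Iab dI d_max); apply: sub0set.
- move=> /nested_number_gt1[c [d [e [cI dI eD eI ced]]]].
  exact: mobius_separated ced eD eI.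
Qed.
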